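(* Let $x:\Sigma^2\to\mathbb{R}^3$ be a non-tubular linear Weingarten surface with a family of circular curvature lines (that is, a non-tubular channel linear Weingarten surface). Then $x$ is a surface of revolution.
   Context: Surfaces are smooth, connected, immersed surfaces $x:\Sigma^2\to\mathbb{R}^3$ in Euclidean 3-space with unit normal field $n$. The principal curvatures $\kappa_1,\kappa_2$ are the eigenvalues of the shape operator, with sign convention $\mathrm{II}=-\langle dx,dn\rangle$; $K=\kappa_1\kappa_2$ is the Gauss curvature and $H=\tfrac12(\kappa_1+\kappa_2)$ the mean curvature. A surface is linear Weingarten if there are real constants $a,b,c$, not all zero, with $aK+2bH+c=0$ on $\Sigma^2$. The discriminant of this condition is $\Delta:=b^2-ac$. If $\Delta=0$, the condition factorizes as $0=(a\kappa_1+b)(a\kappa_2+b)$, so that one principal curvature is constant, $\kappa_i\equiv-\tfrac{b}{a}$. A linear Weingarten surface is called tubular if it satisfies such a condition with $\Delta=0$ (it is then developable or a tube of constant radius about a curve) or if it is totally umbilic. Otherwise it is called non-tubular; a non-tubular linear Weingarten surface has $\Delta\neq0$. A channel surface is a surface with a family of circular curvature lines, i.e. one of the families of curvature lines foliating the surface consists of (arcs of) circles; families containing straight lines, as on developable surfaces, are excluded. A surface of revolution is a (part of a) surface generated by rotating a profile curve about a fixed axis. *)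

(* Defs.v *)
From HB Require Import structures.
From mathcomp Require Import all_boot all_order all_algebra.
From mathcomp Require Import all_classical all_reals all_analysis.
Set Implicit Arguments.
Unset Strict Implicit.
Unset Printing Implicit Defensive.
Import Order.TTheory GRing.Theory Num.Theory.
Import numFieldNormedType.Exports.
Local Open Scope classical_set_scope.
Local Open Scope ring_scope.

(* On an open set U this is C^oo: every iterated directional derivative of f
   exists and is differentiable at every point of U. *)
Definition smooth_on (R : realType) (V W : normedModType R) (U : set V)
    (f : V -> W) : Prop :=
  forall (vs : seq V) (p : V), U p ->
    differentiable (foldr (fun v g => 'D_v g) f vs) p.

Definition dot (R : realType) (u v : 'rV[R]_3) : R := (u *m v^T) 0 0.

Definition orthonormal2 (R : realType) (e1 e2 : 'rV[R]_3) : Prop :=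
  [/\ dot e1 e1 = 1, dot e2 e2 = 1 & dot e1 e2 = 0].

Definition orthonormal3 (R : realType) (e1 e2 e3 : 'rV[R]_3) : Prop :=
  [/\ orthonormal2 e1 e2, dot e3 e3 = 1, dot e1 e3 = 0 & dot e2 e3 = 0].

(* A chart is given by a local parametrization [param], defined on [pdom], together
   with the coordinate map [coords] inverse to it; the values of [param] off [pdom]
   and of [coords] off the image of [pdom] carry no information. *)
Record chart (R : realType) (S : topologicalType) := Chart {
  pdom : set 'rV[R]_2;
  param : 'rV[R]_2 -> S;
  coords : S -> 'rV[R]_2;
  pdom_open : open pdom;
  range_open : open (param @` pdom);
  param_continuous : {within pdom, continuous param};
  coords_continuous : {within param @` pdom, continuous coords};
  paramK : forall u, pdom u -> coords (param u) = u }.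

Section Charts.
Variables (R : realType) (S : topologicalType).
Implicit Types (phi psi : chart R S) (A F : set (chart R S)).

Definition overlap phi psi : set 'rV[R]_2 :=
  pdom phi `&` param phi @^-1` (param psi @` pdom psi).

Definition transition phi psi : 'rV[R]_2 -> 'rV[R]_2 := coords psi \o param phi.

Definition compatible phi psi : Prop :=
  smooth_on (overlap phi psi) (transition phi psi) /\
  smooth_on (overlap psi phi) (transition psi phi).

Definition covering A : Prop :=
  forall p : S, exists2 phi, A phi & (param phi @` pdom phi) p.

Definition smooth_atlas A : Prop :=
  covering A /\ forall phi psi, A phi -> A psi -> compatible phi psi.

Definition smooth_map A (W : normedModType R) (f : S -> W) : Prop :=
  forall phi, A phi -> smooth_on (pdom phi) (f \o param phi).

Definition connected_smooth_surface A : Prop :=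
  [/\ hausdorff_space S, @second_countable S, connected [set: S]
    & smooth_atlas A].

Definition immersion A (x : S -> 'rV[R]_3) : Prop :=
  smooth_map A x /\
  forall phi u, A phi -> pdom phi u -> injective ('d (x \o param phi) u).

Definition unit_normal A (x n : S -> 'rV[R]_3) : Prop :=
  [/\ smooth_map A n, forall p, dot (n p) (n p) = 1
    & forall phi u v, A phi -> pdom phi u ->
        dot (n (param phi u)) ('d (x \o param phi) u v) = 0].

Definition immersed_surface A (x n : S -> 'rV[R]_3) : Prop :=
  [/\ connected_smooth_surface A, immersion A x & unit_normal A x n].

(* ['J f u] has the partial derivatives of f at u as its rows, so these are
   the Gram matrices of <dx,dx> and -<dx,dn> in the coordinates of [phi]. *)
Definition first_form (x : S -> 'rV[R]_3) phi (u : 'rV[R]_2) : 'M[R]_2 :=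
  let Jx := 'J (x \o param phi) u in Jx *m Jx^T.

Definition second_form (x n : S -> 'rV[R]_3) phi (u : 'rV[R]_2) : 'M[R]_2 :=
  let Jx := 'J (x \o param phi) u in
  let Jn := 'J (n \o param phi) u in - (Jx *m Jn^T).

(* The matrix M of the shape operator acts on row vectors:
   II(v, w) = I(v *m M, w). *)
Definition shape_operator (x n : S -> 'rV[R]_3) phi (u : 'rV[R]_2) : 'M[R]_2 :=
  second_form x n phi u *m invmx (first_form x phi u).

(* k1 p, k2 p are the eigenvalues of the shape operator at p, with
   multiplicity, in an arbitrary order at each point. *)
Definition principal_curvatures A (x n : S -> 'rV[R]_3) (k1 k2 : S -> R) : Prop :=
  forall phi u, A phi -> pdom phi u ->
    char_poly (shape_operator x n phi u) =
    ('X - (k1 (param phi u))%:P) * ('X - (k2 (param phi u))%:P).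

Definition gauss_curvature (k1 k2 : S -> R) (p : S) : R := k1 p * k2 p.

Definition mean_curvature (k1 k2 : S -> R) (p : S) : R := (k1 p + k2 p) / 2.

Definition weingarten_condition (k1 k2 : S -> R) (a b c : R) : Prop :=
  [|| a != 0, b != 0 | c != 0] /\
  forall p, a * gauss_curvature k1 k2 p + 2 * b * mean_curvature k1 k2 p + c = 0.

Definition discriminant (a b c : R) : R := b ^+ 2 - a * c.

Definition linear_weingarten (k1 k2 : S -> R) : Prop :=
  exists a b c, weingarten_condition k1 k2 a b c.

Definition totally_umbilic (k1 k2 : S -> R) : Prop := forall p, k1 p = k2 p.

Definition tubular (k1 k2 : S -> R) : Prop :=
  (exists a b c, weingarten_condition k1 k2 a b c /\ discriminant a b c = 0)
  \/ totally_umbilic k1 k2.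

(* A one-dimensional foliation, given by foliated charts: the domains are boxes
   and the plaques are the slices u_1 = const, so that the transition maps
   send d/du_0 to a multiple of itself. *)
Definition open_box (U : set 'rV[R]_2) : Prop :=
  exists a0 b0 a1 b1 : R,
    U = [set u | a0 < u 0 0 < b0 /\ a1 < u 0 1 < b1].

Definition foliated_atlas A F : Prop :=
  [/\ covering F,
      forall phi, F phi -> open_box (pdom phi),
      forall phi psi, F phi -> A psi -> compatible phi psi
    & forall phi psi u, F phi -> F psi -> overlap phi psi u ->
        'J (transition phi psi) u 0 1 = 0].

Definition circle (C : set 'rV[R]_3) : Prop :=
  exists o e1 e2 r, [/\ 0 < r, orthonormal2 e1 e2
    & C = range (fun theta : R =>
        o + (r * cos theta) *: e1 + (r * sin theta) *: e2)].

Definition consists_of_curvature_lines (x n : S -> 'rV[R]_3) F : Prop :=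
  forall phi u, F phi -> pdom phi u ->
    exists k, ((delta_mx 0 0 : 'rV[R]_2)
               <= eigenspace (shape_operator x n phi u) k)%MS.

Definition consists_of_circular_arcs (x : S -> 'rV[R]_3) F : Prop :=
  forall phi (s : R), F phi -> exists2 C, circle C
    & forall u, pdom phi u -> u 0 1 = s -> C (x (param phi u)).

Definition channel_surface A (x n : S -> 'rV[R]_3) : Prop :=
  exists F, [/\ foliated_atlas A F, consists_of_curvature_lines x n F
    & consists_of_circular_arcs x F].

(* c = (radius, height) is the profile curve in a plane through the axis
   o + R e3; near each point of S, the points of x arise by rotating c t about
   the axis, with a parameter t that depends continuously on the point of S.
   The profile may meet the axis or be closed, hence t is only local. *)
Definition surface_of_revolution (x : S -> 'rV[R]_3) : Prop :=
  exists (o e1 e2 e3 : 'rV[R]_3) (I : set R) (c : R -> 'rV[R]_2),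
  [/\ orthonormal3 e1 e2 e3,
      open I /\ is_interval I,
      smooth_on (I : set R^o) (c : R^o -> 'rV[R]_2)
        /\ (forall t, I t -> derive1 c t != 0)
    & forall p : S, exists t : S -> R, \forall q \near p,
        [/\ {for q, continuous t}, I (t q)
          & exists theta : R,
              x q = o + (c (t q) 0 0 * cos theta) *: e1
                      + (c (t q) 0 0 * sin theta) *: e2
                      + c (t q) 0 1 *: e3]].

End Charts.

(* Main.v *)
Require Import Defs.
From HB Require Import structures.
From mathcomp Require Import all_boot all_order all_algebra.
From mathcomp Require Import ring lra.
From mathcomp Require Import all_classical all_reals all_analysis.
Import Order.TTheory GRing.Theory Num.Theory.
Import numFieldNormedType.Exports.
Local Open Scope classical_set_scope.
Local Open Scope ring_scope.

(** Why a non-tubular channel linear Weingarten surface is rotational.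

    Along a leaf, an arc of a circle with centre C, unit axis vector B and
    radius r, the derivative of the normal n is - kappa times the tangent.
    Differentiating <n, x - C> and <n, B> along the leaf shows that both are
    constant, so n = - kappa (x - C) + q B with constant kappa and q
    ([leaf_normal]).  The relation a kappa lambda + b (kappa + lambda) + c = 0
    can be solved for lambda because a kappa + b <> 0 when the discriminant
    does not vanish ([weingarten_slope]); hence the second principal curvature
    lambda is constant along the leaf as well.

    Let the leaf vary with a transverse parameter t.  Three points of a leaf
    determine its circle, so C, B, r, kappa and q are differentiable in t.  The
    vector n_t + lambda x_t is tangent to the leaf and x_t is orthogonal to n;
    tested against x - C, B and n these facts are affine in the position on the
    circle, and comparing coefficients ([axial], [leaf_variation]) gives

        (kappa - lambda) B' = 0,   (kappa - lambda) (C' - <C', B> B) = 0,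
        (kappa r)' = lambda r',    q' = - lambda <C', B>,
        kappa r r' = q <C', B>.

    It follows that r^2 (a kappa^2 + 2 b kappa + c), which equals
    r^2 (a kappa + b) (kappa - lambda), does not depend on t.  On the
    connected surface it is one global constant, and it is not zero, since
    otherwise every point would be umbilic ([leaf_integral_neq0]).  Therefore
    kappa <> lambda everywhere, the axis line of the leaves is locally constant,
    and all leaves are circles about one axis ([common_axis]).

    What remains is to find one profile curve for the whole surface, although
    its leaf space need not even be Hausdorff.  With p = kappa r, the state
    (r, h, p, q) of a point, where h is the height along the axis, moves across
    the leaves along the curves of a polynomial vector field
    ([patch_state_derive]).  Local arcs of integral curves are thus given by
    the surface itself, and since integral curves are unique they fit into a
    single maximal one ([max_curve]).  The points whose state lies on the
    maximal curve through a given state form an open and closed set, so all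
    states do ([on_profile]), and the first two components of the maximal curve
    are the profile.

    The foliated charts are tied to the atlas only through transition maps, so
    the first-order data above are first established in the charts of the atlas
    and then transported; the symmetry of the second fundamental form comes
    from the symmetry of second derivatives ([derive_symmetric]). *)

Set Implicit Arguments.
Unset Strict Implicit.
Unset Printing Implicit Defensive.

(** * Vectors in Euclidean 3-space *)
Section Vectors.
Variable R : realType.
Implicit Types (u v w : 'rV[R]_3) (k : R).

Lemma dotE u v : dot u v = u 0 0 * v 0 0 + u 0 1 * v 0 1 + u 0 2 * v 0 2.
Proof.
rewrite /dot mxE !big_ord_recr big_ord0 /= add0r !mxE.
by congr (_ * _ + _ * _ + _ * _); congr (_ _ _); apply/val_inj.
Qed.

Lemma row3P u v :
  u 0 0 = v 0 0 -> u 0 1 = v 0 1 -> u 0 2 = v 0 2 -> u = v.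
Proof.
move=> e0 e1 e2; apply/rowP => -[[|[|[|//]]] hi].
- by rewrite (_ : Ordinal hi = 0)//; apply/val_inj.
- by rewrite (_ : Ordinal hi = 1)//; apply/val_inj.
- by rewrite (_ : Ordinal hi = 2)//; apply/val_inj.
Qed.

Definition row3 (a b c : R) : 'rV[R]_3 := \row_i nth 0 [:: a; b; c] i.

Definition cross u v : 'rV[R]_3 :=
  row3 (u 0 1 * v 0 2 - u 0 2 * v 0 1)
       (u 0 2 * v 0 0 - u 0 0 * v 0 2)
       (u 0 0 * v 0 1 - u 0 1 * v 0 0).

Lemma row3E (a b c : R) :
  (row3 a b c 0 0 = a) * (row3 a b c 0 1 = b) * (row3 a b c 0 2 = c).
Proof. by rewrite !mxE. Qed.

Lemma dotC u v : dot u v = dot v u.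
Proof. by rewrite !dotE; ring. Qed.
Lemma dotDl u v w : dot (u + v) w = dot u w + dot v w.
Proof. by rewrite !dotE !mxE; ring. Qed.
Lemma dotDr u v w : dot w (u + v) = dot w u + dot w v.
Proof. by rewrite !dotE !mxE; ring. Qed.
Lemma dotNl u v : dot (- u) v = - dot u v.
Proof. by rewrite !dotE !mxE; ring. Qed.
Lemma dotNr u v : dot v (- u) = - dot v u.
Proof. by rewrite !dotE !mxE; ring. Qed.
Lemma dotZl k u v : dot (k *: u) v = k * dot u v.
Proof. by rewrite !dotE !mxE; ring. Qed.
Lemma dotZr k u v : dot v (k *: u) = k * dot v u.
Proof. by rewrite !dotE !mxE; ring. Qed.
Lemma dot0l u : dot 0 u = 0.
Proof. by rewrite !dotE !mxE; ring. Qed.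

Definition dotL := (dotDl, dotDr, dotNl, dotNr, dotZl, dotZr).

Lemma dot_ge0 u : 0 <= dot u u.
Proof. by rewrite dotE -!expr2 !addr_ge0 ?sqr_ge0. Qed.

Lemma dot_eq0 u : dot u u = 0 -> u = 0.
Proof.
rewrite dotE -!expr2 => h.
by apply: row3P; rewrite mxE; apply/eqP; rewrite -sqrf_eq0; apply/eqP; nra.
Qed.

Lemma dot_gt0 u : u != 0 -> 0 < dot u u.
Proof.
by move=> u0; rewrite lt0r dot_ge0 andbT; apply: contra u0 => /eqP/dot_eq0/eqP.
Qed.

Lemma dot_crossl u v : dot (cross u v) u = 0.
Proof. by rewrite dotE !row3E; ring. Qed.
Lemma dot_crossr u v : dot (cross u v) v = 0.
Proof. by rewrite dotE !row3E; ring. Qed.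

(** The triple v x c, c x u, c with c = u x v is, up to the factor |c|^2, the
    basis dual to u, v, c. *)
Lemma cross_expand u v w : let c := cross u v in
  dot c c *: w = dot w u *: cross v c + dot w v *: cross c u + dot w c *: c.
Proof. by apply: row3P; rewrite /= !mxE !dotE !mxE /=; ring. Qed.

Lemma cross_orth u v w : cross u v != 0 -> dot w u = 0 -> dot w v = 0 ->
  dot w (cross u v) = 0 -> w = 0.
Proof.
move=> c0 wu wv wc; apply/eqP; have := cross_expand u v w => /= /eqP.
by rewrite wu wv wc !scale0r !addr0 scaler_eq0 gt_eqF ?dot_gt0.
Qed.

Lemma cross_norm2 u v :
  dot (cross u v) (cross u v) = dot u u * dot v v - dot u v ^+ 2.
Proof. by rewrite !dotE !row3E; ring. Qed.

Lemma cross0l u : cross 0 u = 0.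
Proof. by apply: row3P; rewrite /cross !mxE /=; ring. Qed.

End Vectors.

(** * Derivatives of scalar and vector-valued functions *)
Section Calculus.
Variable R : realType.

Lemma is_derive_mxP (V : normedModType R) m n (f : V -> 'M[R]_(m.+1, n.+1)) (t v : V) df :
  is_derive t v f df <-> forall i j, is_derive t v (fun s => f s i j : R) (df i j).
Proof.
split=> [[h <-] i j|h].
  rewrite derive_mx// mxE.
  by apply: DeriveDef => //; exact: ((derivable_mxP _ _ _).1 h).
have d : derivable f t v by apply/derivable_mxP => i j; have [] := h i j.
apply: DeriveDef => //; rewrite derive_mx//; apply/matrixP => i j.
by rewrite mxE; have [] := h i j.
Qed.

Lemma is_derive_val (V W : normedModType R) (f : V -> W) (t v : V) d d' :
  is_derive t v f d -> d = d' -> is_derive t v f d'.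
Proof. by move=> h <-. Qed.

Lemma is_derive_add (V W : normedModType R) (f g : V -> W) (t v : V) df dg :
  is_derive t v f df -> is_derive t v g dg ->
  is_derive t v (fun s => f s + g s) (df + dg).
Proof. by move=> hf hg; apply: is_deriveD. Qed.

Lemma is_derive_opp (V W : normedModType R) (f : V -> W) (t v : V) df :
  is_derive t v f df -> is_derive t v (fun s => - f s) (- df).
Proof. by move=> hf; apply: is_deriveN. Qed.

Lemma is_derive_sub (V W : normedModType R) (f g : V -> W) (t v : V) df dg :
  is_derive t v f df -> is_derive t v g dg ->
  is_derive t v (fun s => f s - g s) (df - dg).
Proof. by move=> hf hg; apply: is_deriveB. Qed.

Lemma is_derive_mul (V : normedModType R) (f g : V -> R) (t v : V) df dg :
  is_derive t v f df -> is_derive t v g dg ->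
  is_derive t v (fun s => f s * g s) (df * g t + f t * dg).
Proof.
move=> hf hg; apply: (is_derive_val (is_deriveM hf hg)).
by rewrite /GRing.scale /=; ring.
Qed.

Lemma is_derive_inv (V : normedModType R) (f : V -> R) (t v : V) df : f t != 0 ->
  is_derive t v f df -> is_derive t v (fun s => (f s)^-1) (- df / f t ^+ 2).
Proof.
move=> f0 [hf <-]; apply: DeriveDef; first exact: derivableV.
by rewrite deriveV// /GRing.scale /= mulrC mulrN mulNr.
Qed.

Lemma is_derive_comp (f g : R -> R) (t df dg : R) :
  is_derive (g t) 1 f df -> is_derive t 1 g dg ->
  is_derive t 1 (fun s => f (g s)) (df * dg).
Proof. by move=> hf hg; exact: (is_derive1_comp hf hg). Qed.

Lemma is_derive_continuous (V : normedModType R) (f : R -> V) (t : R) df :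
  is_derive t 1 f df -> {for t, continuous f}.
Proof. by move=> [/derivable1_diffP/differentiable_continuous]. Qed.

Lemma constant_on_itv (f : R -> R) (a b : R) :
  (forall t, a < t < b -> is_derive t 1 f 0) ->
  forall s t, a < s < b -> a < t < b -> f s = f t.
Proof.
move=> df; suff W s t : a < s < b -> a < t < b -> s <= t -> f s = f t.
  move=> s t hs ht; case/orP: (le_total s t) => st; first exact: W.
  by apply/esym/W.
move=> /andP[as_ sb] /andP[at_ tb] st.
have dst x : s <= x <= t -> is_derive x 1 f 0.
  move=> /andP[sx xt]; apply: df.
  by rewrite (lt_le_trans as_ sx) (le_lt_trans xt tb).
have cf : {within `[s, t], continuous f}.
  apply: derivable_within_continuous => x; rewrite in_itv/= => /dst.
  by case.
have [x|c _] := @MVT_segment R f (cst 0) s t st _ cf.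
  by rewrite in_itv/= => /andP[sx xt]; apply: dst; rewrite !ltW.
by rewrite /cst mul0r => /eqP; rewrite subr_eq0 => /eqP ->.
Qed.

Lemma constant_near (f : R -> R) (t0 : R) :
  (\forall t \near t0, is_derive (t : R) 1 f 0) -> \forall t \near t0, f t = f t0.
Proof.
move=> /nbhs_ballP[e /= e0 he]; apply/nbhs_ballP; exists e => // t.
rewrite /ball /= => h.
apply: (@constant_on_itv _ (t0 - e) (t0 + e)).
- by move=> s hs; apply: he; rewrite /ball/= ltr_distlC; lra.
- by move: h; rewrite ltr_distlC; lra.
- by lra.
Qed.

Lemma is_derive_rowP (V : normedModType R) n (f : V -> 'rV[R]_n.+1) (t v : V) df :
  is_derive t v f df <-> forall i, is_derive t v (fun s => f s 0 i : R) (df 0 i).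
Proof.
rewrite is_derive_mxP; split=> h; first by move=> i; exact: h.
by move=> i j; rewrite ord1; exact: h.
Qed.

Lemma is_derive_row3 (V : normedModType R) (f0 f1 f2 : V -> R) (t v : V) d0 d1 d2 :
  is_derive t v f0 d0 -> is_derive t v f1 d1 -> is_derive t v f2 d2 ->
  is_derive t v (fun s => row3 (f0 s) (f1 s) (f2 s)) (row3 d0 d1 d2).
Proof.
move=> h0 h1 h2; apply/is_derive_rowP => -[[|[|[|//]]] hi].
- rewrite (_ : Ordinal hi = 0); last exact/val_inj.
  by under eq_fun do rewrite row3E; rewrite row3E.
- rewrite (_ : Ordinal hi = 1); last exact/val_inj.
  by under eq_fun do rewrite row3E; rewrite row3E.
- rewrite (_ : Ordinal hi = 2); last exact/val_inj.
  by under eq_fun do rewrite row3E; rewrite row3E.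
Qed.

Lemma is_derive_scale (V : normedModType R) n (k : V -> R) (f : V -> 'rV[R]_n.+1)
  (t v : V) dk df :
  is_derive t v k dk -> is_derive t v f df ->
  is_derive t v (fun s => k s *: f s) (dk *: f t + k t *: df).
Proof.
move=> hk /is_derive_rowP hf; apply/is_derive_rowP => i.
under eq_fun do rewrite mxE; rewrite !mxE; exact: is_derive_mul.
Qed.

Lemma is_derive_dot (V : normedModType R) (f g : V -> 'rV[R]_3) (t v : V) df dg :
  is_derive t v f df -> is_derive t v g dg ->
  is_derive t v (fun s => dot (f s) (g s)) (dot df (g t) + dot (f t) dg).
Proof.
move=> /is_derive_rowP hf /is_derive_rowP hg.
under eq_fun do rewrite dotE.
apply: (is_derive_val (is_derive_add
  (is_derive_add (is_derive_mul (hf 0) (hg 0))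
     (is_derive_mul (hf 1) (hg 1)))
  (is_derive_mul (hf 2) (hg 2)))).
by rewrite !dotE; ring.
Qed.

Lemma is_derive_cross (V : normedModType R) (f g : V -> 'rV[R]_3) (t v : V) df dg :
  is_derive t v f df -> is_derive t v g dg ->
  is_derive t v (fun s => cross (f s) (g s)) (cross df (g t) + cross (f t) dg).
Proof.
move=> /is_derive_rowP hf /is_derive_rowP hg.
have D i j := is_derive_sub
  (is_derive_mul (hf i) (hg j)) (is_derive_mul (hf j) (hg i)).
apply: (is_derive_val (is_derive_row3 (D 1 2) (D 2 0) (D 0 1))).
by apply: row3P; rewrite !mxE /=; ring.
Qed.

End Calculus.

(** * Circles in space *)
Section Circles.
Variable R : realType.
Implicit Types (u v w X N C B U : 'rV[R]_3) (r k : R).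

Definition on_circle C B r X :=
  dot (X - C) (X - C) = r ^+ 2 /\ dot (X - C) B = 0.

Lemma cross_neq0_orth u B r : 0 < r -> dot B B = 1 -> dot u u = r ^+ 2 ->
  dot u B = 0 -> cross u B != 0.
Proof.
move=> r0 BB uu uB; apply/eqP => c0; have := cross_norm2 u B.
rewrite c0 dot0l BB uu uB expr0n subr0 mulr1 => /esym/eqP.
by rewrite sqrf_eq0 gt_eqF.
Qed.

(** A nonzero t orthogonal to u and v spans the line of u x v, so a vector
    orthogonal to u, v and t is orthogonal to a basis. *)
Lemma orth_frame u v t w : cross u v != 0 -> t != 0 ->
  dot t u = 0 -> dot t v = 0 -> dot w t = 0 -> dot w u = 0 -> dot w v = 0 ->
  w = 0.
Proof.
move=> c0 t0 tu tv wt wu wv; apply: (cross_orth c0 wu wv).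
have := cross_expand u v t; rewrite /= tu tv !scale0r !add0r => e.
have : dot w (dot (cross u v) (cross u v) *: t) = 0 by rewrite dotZr wt mulr0.
rewrite e dotZr => /eqP; rewrite mulf_eq0 => /orP[/eqP tc|/eqP //].
by case/eqP: t0; exact: (cross_orth c0 tu tv tc).
Qed.

(** The circle through three points as an explicit function of the points:
    this makes evident that it depends differentiably on them. *)
Definition axis3 u v w : 'rV[R]_3 := cross (v - u) (w - u).
Definition unit_axis3 u v w : 'rV[R]_3 :=
  (Num.sqrt (dot (axis3 u v w) (axis3 u v w)))^-1 *: axis3 u v w.
Definition centre3 u v w : 'rV[R]_3 :=
  u + (2 * dot (axis3 u v w) (axis3 u v w))^-1 *:
   (dot (v - u) (v - u) *: cross (w - u) (axis3 u v w)
    + dot (w - u) (w - u) *: cross (axis3 u v w) (v - u)).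
Definition radius3 u v w : R :=
  Num.sqrt (dot (u - centre3 u v w) (u - centre3 u v w)).

Lemma unit_axis3_unit u v w : axis3 u v w != 0 ->
  dot (unit_axis3 u v w) (unit_axis3 u v w) = 1.
Proof.
move=> a0; rewrite !dotL mulrA -invfM -expr2 sqr_sqrtr ?dot_ge0//.
by rewrite mulVf// gt_eqF// dot_gt0.
Qed.

(** The vector from u to the centre solves three independent linear equations:
    equidistance of the centre from u and v, from u and w, and orthogonality to
    the axis. *)
Lemma circle3 C B r u v w : 0 < r -> dot B B = 1 ->
  on_circle C B r u -> on_circle C B r v -> on_circle C B r w ->
  axis3 u v w != 0 ->
  [/\ C = centre3 u v w, r = radius3 u v w
    & B = unit_axis3 u v w \/ B = - unit_axis3 u v w].
Proof.
move=> r0 BB [uC uB] [vC vB] [wC wB] a0.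
have a1 : dot (axis3 u v w) (axis3 u v w) != 0 by rewrite gt_eqF ?dot_gt0.
have Bvu : dot B (v - u) = 0.
  have -> : dot B (v - u) = dot (v - C) B - dot (u - C) B.
    by rewrite !dotE !mxE; ring.
  by rewrite vB uB subrr.
have Bwu : dot B (w - u) = 0.
  have -> : dot B (w - u) = dot (w - C) B - dot (u - C) B.
    by rewrite !dotE !mxE; ring.
  by rewrite wB uB subrr.
have Ba : dot (axis3 u v w) (axis3 u v w) *: B = dot B (axis3 u v w) *: axis3 u v w.
  by rewrite [LHS](cross_expand (v - u) (w - u) B) Bvu Bwu !scale0r !add0r.
have aC : dot (axis3 u v w) (u - C) = 0.
  have : dot (dot (axis3 u v w) (axis3 u v w) *: B) (u - C) = 0.
    by rewrite dotZl dotC uB mulr0.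
  rewrite Ba dotZl => /eqP; rewrite mulf_eq0 => /orP[/eqP Ba0|/eqP//].
  move: Ba; rewrite Ba0 scale0r => /eqP; rewrite scaler_eq0 (negbTE a1) /=.
  by move=> /eqP B0; move: BB; rewrite B0 dot0l => /esym/eqP; rewrite oner_eq0.
have eC : C = centre3 u v w.
  have h1 : dot (C - u) (v - u) = dot (v - u) (v - u) / 2.
    by move: uC vC; rewrite !dotE !mxE; nra.
  have h2 : dot (C - u) (w - u) = dot (w - u) (w - u) / 2.
    by move: uC wC; rewrite !dotE !mxE; nra.
  have h3 : dot (C - u) (axis3 u v w) = 0.
    by rewrite dotC -opprB dotNr aC oppr0.
  have := cross_expand (v - u) (w - u) (C - u); rewrite /= -/(axis3 u v w).
  rewrite h1 h2 h3 scale0r addr0 => e.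
  rewrite /centre3 -[LHS](subrK u) addrC; congr (_ + _).
  apply: (scalerI a1); rewrite e scalerA invfM mulrCA mulfV// mulr1.
  by rewrite scalerDr !scalerA !(mulrC 2^-1).
split=> //; first by rewrite /radius3 -eC uC sqrtr_sqr gtr0_norm.
have Be : B = dot B (unit_axis3 u v w) *: unit_axis3 u v w.
  apply: (scalerI a1); rewrite Ba dotZr !scalerA; congr (_ *: _).
  have s0 : Num.sqrt (dot (axis3 u v w) (axis3 u v w)) != 0.
    by rewrite gt_eqF// sqrtr_gt0 dot_gt0.
  have ss := sqr_sqrtr (dot_ge0 (axis3 u v w)).
  by rewrite -[X in _ = X * _ / _]ss; field.
move: (unit_axis3_unit a0) Be; move: (unit_axis3 u v w) => e ee Be.
have : dot B e ^+ 2 = 1 by rewrite -[RHS]BB {2 3}Be !dotL ee; ring.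
move=> /eqP; rewrite sqrf_eq1 => /orP[]/eqP h; rewrite h in Be.
  by left; rewrite Be scale1r.
by right; rewrite Be scaleN1r.
Qed.

(** This replaces comparing the coefficients of a trigonometric polynomial in
    the angle: the differences of three points of a circle span its plane, so U
    has no component in that plane, and then K is the value of U at a radius. *)
Lemma axial U C B r u v w K : 0 < r -> dot B B = 1 ->
  on_circle C B r u -> on_circle C B r v -> on_circle C B r w ->
  axis3 u v w != 0 ->
  dot U (u - C) = K -> dot U (v - C) = K -> dot U (w - C) = K ->
  K = 0 /\ U = dot U B *: B.
Proof.
move=> r0 BB hu hv hw a0 Uu Uv Uw.
have [_ _ Bw] := circle3 r0 BB hu hv hw a0.
have e : U = dot U B *: B.
  apply/eqP; rewrite -subr_eq0; apply/eqP.
  case: hu hv hw => [_ uB] [_ vB] [_ wB].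
  apply: (cross_orth a0).
  - transitivity (dot U (v - C) - dot U (u - C)
      - dot U B * (dot (v - C) B - dot (u - C) B)).
      by rewrite !dotE !mxE; ring.
    by rewrite Uu Uv uB vB; ring.
  - transitivity (dot U (w - C) - dot U (u - C)
      - dot U B * (dot (w - C) B - dot (u - C) B)).
      by rewrite !dotE !mxE; ring.
    by rewrite Uu Uw uB wB; ring.
  - have s0 : Num.sqrt (dot (axis3 u v w) (axis3 u v w)) != 0.
      by rewrite gt_eqF// sqrtr_gt0 dot_gt0.
    have -> : cross (v - u) (w - u) =
        Num.sqrt (dot (axis3 u v w) (axis3 u v w)) *: unit_axis3 u v w.
      by rewrite scalerA mulfV// scale1r.
    move: (unit_axis3_unit a0) Bw; move: (unit_axis3 u v w) => e ee.
    by case=> ->; rewrite !dotL ee; ring.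
split=> //; rewrite -Uu {1}e dotZl.
by case: hu => _; rewrite dotC => ->; rewrite mulr0.
Qed.

End Circles.

(** * The normal along a circular curvature line, and its variation *)
Section Leaves.
Variable R : realType.
Implicit Types (C B : 'rV[R]_3).

Lemma near_itv (a b t : R) : a < t < b -> \forall s \near t, a < s < b.
Proof.
move=> h; have : t \in `]a, b[ by rewrite in_itv.
by move=> /near_in_itvoo; apply: filterS => s; rewrite in_itv.
Qed.

Lemma is_derive_near_unique (V W : normedModType R) (f g : V -> W) (t v : V) df dg :
  (\forall s \near t, f s = g s) -> is_derive t v f df -> is_derive t v g dg ->
  df = dg.
Proof.
move=> fg hf hg; rewrite -[LHS](@derive_val _ _ _ _ _ _ _ hf).
by rewrite (near_eq_derive _ fg); apply: derive_val.
Qed.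

Lemma circle_tangent (X : R -> 'rV[R]_3) (s : R) C B r T :
  (\forall u \near s, on_circle C B r (X u)) -> is_derive s 1 X T ->
  dot T (X s - C) = 0 /\ dot T B = 0.
Proof.
move=> H dX.
have dXC : is_derive s 1 (fun s => X s - C) T.
  by apply: (is_derive_val (is_derive_sub dX (is_derive_cst C s 1))); rewrite subr0.
split.
  have : dot T (X s - C) + dot (X s - C) T = 0.
    apply: (is_derive_near_unique _ (is_derive_dot dXC dXC)
      (is_derive_cst (r ^+ 2) s 1)).
    by apply: filterS H => u [].
  by rewrite (dotC (X s - C)); lra.
have : dot T B + dot (X s - C) 0 = 0.
  apply: (is_derive_near_unique _ (is_derive_dot dXC (is_derive_cst B s 1))
    (is_derive_cst 0 s 1)).
  by apply: filterS H => u [].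
by rewrite (dotC _ 0) dot0l addr0.
Qed.

(** The tangent T is orthogonal to X - C and B, and so is N' = - kappa T; hence
    the components of N along X - C and B do not change.  As N has no component
    along T, they determine N, and comparing the two expressions of N' yields
    kappa. *)
Lemma leaf_normal (a b s0 : R) (X N T : R -> 'rV[R]_3) (kappa : R -> R) C B r :
  a < s0 < b -> 0 < r -> dot B B = 1 ->
  (forall s, a < s < b -> [/\ on_circle C B r (X s),
     is_derive s 1 X (T s), is_derive s 1 N (- kappa s *: T s),
     T s != 0 & dot (N s) (T s) = 0]) ->
  let k := - (dot (N s0) (X s0 - C) / r ^+ 2) in
  let q := dot (N s0) B in
  forall s, a < s < b -> N s = - k *: (X s - C) + q *: B /\ kappa s = k.
Proof.
move=> hs0 r0 BB H k q.
have Tperp s : a < s < b -> dot (T s) (X s - C) = 0 /\ dot (T s) B = 0.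
  move=> hs; have [_ dX _ _ _] := H s hs; apply: (circle_tangent (r := r) _ dX).
  by apply: filterS (near_itv hs) => u hu; have [] := H u hu.
have cN s : a < s < b -> dot (N s) (X s - C) = dot (N s0) (X s0 - C)
    /\ dot (N s) B = dot (N s0) B.
  move=> hs; split.
    apply: (@constant_on_itv _ (fun s => dot (N s) (X s - C)) a b) => // t ht.
    have [_ dX dN _ NT] := H t ht; have [TX TB] := Tperp t ht.
    apply: (is_derive_val (is_derive_dot dN
      (is_derive_sub dX (is_derive_cst C t 1)))).
    by rewrite subr0 dotZl TX NT mulr0 addr0.
  apply: (@constant_on_itv _ (fun s => dot (N s) B) a b) => // t ht.
  have [_ dX dN _ NT] := H t ht; have [TX TB] := Tperp t ht.
  apply: (is_derive_val (is_derive_dot dN (is_derive_cst B t 1))).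
  by rewrite dotZl TB (dotC _ 0) dot0l mulr0 addr0.
have eN s : a < s < b -> N s = - k *: (X s - C) + q *: B.
  move=> hs; have [[XX XB] dX dN T0 NT] := H s hs; have [TX TB] := Tperp s hs.
  have [c1 c2] := cN s hs.
  apply/eqP; rewrite -subr_eq0; apply/eqP.
  apply: (orth_frame (cross_neq0_orth r0 BB XX XB) T0 TX TB).
  - rewrite dotDl dotNl dotDl !dotZl NT (dotC (X s - C)) (dotC B) TX TB; ring.
  - rewrite dotDl dotNl dotDl !dotZl c1 XX (dotC B) XB /k.
    by field; rewrite gt_eqF.
  - by rewrite dotDl dotNl dotDl !dotZl c2 XB BB /q; ring.
move=> s hs; split; first exact: eN.
have [_ dX dN T0 _] := H s hs.
have : - kappa s *: T s = - k *: T s.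
  apply: (is_derive_near_unique (g := fun s => - k *: (X s - C) + q *: B) _ dN).
    by apply: filterS (near_itv hs) => u; exact: eN.
  apply: (is_derive_val (is_derive_add (is_derive_scale
    (is_derive_cst (- k) s 1) (is_derive_sub dX (is_derive_cst C s 1)))
    (is_derive_cst (q *: B) s 1))).
  by rewrite scale0r add0r addr0 subr0.
by move/eqP; rewrite -subr_eq0 -scalerBl scaler_eq0 (negbTE T0) orbF opprK; lra.
Qed.

(** The primed arguments are the derivatives of the data in the transverse
    parameter.  Each of the three scalar conditions on X' and N' says that an
    affine function of the position is constant on the circle; [axial] turns it
    into one scalar and one vector equation.  The vector equations state that
    q B' + lam C', (k - lam) B' and k C' + q B' are parallel to B. *)
Lemma leaf_variation C B r k q C' B' r' k' q' lam
    (X X' N' : 'I_3 -> 'rV[R]_3) :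
  0 < r -> dot B B = 1 -> dot B' B = 0 ->
  axis3 (X 0) (X 1) (X 2) != 0 ->
  (forall i, let d := X i - C in let d' := X' i - C' in
    [/\ on_circle C B r (X i), dot d' d = r * r', dot d' B + dot d B' = 0,
        N' i = - k' *: d - k *: d' + q' *: B + q *: B'
      & [/\ dot (X' i) (- k *: d + q *: B) = 0,
        dot (N' i + lam *: X' i) d = 0 & dot (N' i + lam *: X' i) B = 0]]) ->
  [/\ k' * r + k * r' = lam * r', q' = - lam * dot C' B,
      k * r * r' = q * dot C' B
    & k != lam -> B' = 0 /\ C' = dot C' B *: B].
Proof.
move=> r0 BB B'B a0 H.
have hc i : on_circle C B r (X i) by case: (H i).
have [e1 v1] : k' * r ^+ 2 + k * r * r' - lam * r * r' = 0 /\
    q *: B' + lam *: C' = dot (q *: B' + lam *: C') B *: B.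
  suff W i : dot (q *: B' + lam *: C') (X i - C) =
      k' * r ^+ 2 + k * r * r' - lam * r * r'.
    by apply: (axial r0 BB (hc 0) (hc 1) (hc 2) a0).
  move: (H i) => /=; have [d' eX] : exists d', X' i = d' + C'.
    by exists (X' i - C'); rewrite subrK.
  rewrite eX addrK /on_circle; move: (X i - C) => d.
  move=> [[dd dB] d'd d'B -> [_ + _]].
  rewrite !dotL (dotC B d) d'd dd dB => h; lra.
have [e2 v2] : - q' - lam * dot C' B = 0 /\
    (k - lam) *: B' = dot ((k - lam) *: B') B *: B.
  suff W i : dot ((k - lam) *: B') (X i - C) = - q' - lam * dot C' B.
    by apply: (axial r0 BB (hc 0) (hc 1) (hc 2) a0).
  move: (H i) => /=; have [d' eX] : exists d', X' i = d' + C'.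
    by exists (X' i - C'); rewrite subrK.
  rewrite eX addrK /on_circle; move: (X i - C) => d.
  move=> [[dd dB] d'd d'B -> [_ _]].
  rewrite !dotL B'B BB dB => h.
  have h2 : dot d' B = - dot B' d by rewrite (dotC B'); lra.
  move: h; rewrite h2; lra.
have [e3 v3] : q * dot C' B - k * r * r' = 0 /\
    k *: C' + q *: B' = dot (k *: C' + q *: B') B *: B.
  suff W i : dot (k *: C' + q *: B') (X i - C) = q * dot C' B - k * r * r'.
    by apply: (axial r0 BB (hc 0) (hc 1) (hc 2) a0).
  move: (H i) => /=; have [d' eX] : exists d', X' i = d' + C'.
    by exists (X' i - C'); rewrite subrK.
  rewrite eX addrK /on_circle; move: (X i - C) => d.
  move=> [[dd dB] d'd d'B _ [+ _ _]].
  rewrite !dotL d'd => h.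
  have h2 : dot d' B = - dot B' d by rewrite (dotC B'); lra.
  move: h; rewrite h2; lra.
split; [|lra|lra|].
  apply: (mulfI (lt0r_neq0 r0)); lra.
move=> kl; have B0 : B' = 0.
  move: v2; rewrite dotZl B'B mulr0 scale0r => /eqP.
  by rewrite scaler_eq0 subr_eq0 (negbTE kl) => /eqP.
split=> //; move: v1 v3; rewrite B0 !scaler0 add0r addr0 !dotZl => v1 v3.
have : (k - lam) *: C' = (k - lam) *: (dot C' B *: B).
  by rewrite scalerBl v1 v3 -!scalerA -scalerBl.
by apply: scalerI; rewrite subr_eq0.
Qed.

End Leaves.

(** * Three distinct points on an immersed arc *)
Section Distinct.
Variable R : realType.
Implicit Types (C B u v w : 'rV[R]_3).

Lemma derive_neq0_near (f : R -> R) (s l : R) : l != 0 -> is_derive s 1 f l ->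
  \forall h \near 0^', f (h + s) != f s.
Proof.
move=> l0 [df fl]; have : h^-1 *: (f (h *: 1 + s) - f s) @[h --> 0^'] --> l.
  by rewrite -fl; exact: df.
move=> /cvgr_neq0 /(_ l0); apply: filterS => h.
by rewrite [h *: 1]mulr1; apply: contraNneq => ->; rewrite subrr scaler0.
Qed.

Lemma immersed_near (X : R -> 'rV[R]_3) (s : R) T : T != 0 ->
  is_derive s 1 X T -> \forall h \near 0^', X (h + s) != X s.
Proof.
move=> T0 dX; have := derive_neq0_near (f := fun s => dot (X s) T) (l := dot T T).
move=> /(_ s (lt0r_neq0 (dot_gt0 T0))) H.
have /H : is_derive s 1 (fun s => dot (X s) T) (dot T T).
  apply: (is_derive_val (is_derive_dot dX (is_derive_cst T s 1))).
  by rewrite (dotC _ 0) dot0l addr0.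
by apply: filterS => h; apply: contraNneq => ->.
Qed.

Lemma cross_eq0 u v : u != 0 -> cross u v = 0 -> v = (dot u v / dot u u) *: u.
Proof.
move=> u0 c0; apply: (scalerI (lt0r_neq0 (dot_gt0 u0))).
rewrite scalerA mulrCA mulfV ?lt0r_neq0 ?dot_gt0// mulr1.
apply/eqP; rewrite -subr_eq0; apply/eqP; transitivity (cross (cross u v) u).
  by apply: row3P; rewrite /cross !mxE !dotE /=; ring.
by rewrite c0; apply: row3P; rewrite /cross !mxE /=; ring.
Qed.

(** A line meets a circle in at most two points. *)
Lemma axis3_neq0 C B r u v w : on_circle C B r u -> on_circle C B r v ->
  on_circle C B r w -> v != u -> w != u -> v != w -> axis3 u v w != 0.
Proof.
move=> [hu _] [hv _] [hw _] vu wu vw; apply/eqP => a0.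
have v0 : v - u != 0 by rewrite subr_eq0.
have := cross_eq0 v0 a0; set m := _ / _ => wE.
have h1 : 2 * dot (v - u) (u - C) + dot (v - u) (v - u) = 0.
  by move: hu hv; rewrite !dotE !mxE; lra.
have h2 : 2 * dot (w - u) (u - C) + dot (w - u) (w - u) = 0.
  by move: hu hw; rewrite !dotE !mxE; lra.
rewrite wE !(dotZl, dotZr) in h2.
have : m * (m - 1) * dot (v - u) (v - u) = 0.
  by rewrite -[RHS](subr0 0) -{1}h2 -(mulr0 m) -h1; ring.
move=> /eqP; rewrite mulf_eq0 (gt_eqF (dot_gt0 v0)) orbF mulf_eq0 => /orP[]/eqP m0.
  by case/eqP: wu; apply/eqP; rewrite -subr_eq0 wE m0 scale0r.
case/eqP: vw; apply/eqP; rewrite -subr_eq0.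
rewrite (_ : v - w = (v - u) - (w - u)); last by rewrite opprB addrA subrK.
by rewrite wE (_ : m = 1) ?scale1r ?subrr//; lra.
Qed.

(** The second point is chosen near the first because X' does not vanish; the
    third is then so close to the first that it misses the second. *)
Lemma three_points (a b s0 : R) (X : R -> 'rV[R]_3) T : a < s0 < b ->
  T != 0 -> is_derive s0 1 X T ->
  exists s : 'I_3 -> R, (forall i, a < s i < b) /\
    [/\ X (s 1) != X (s 0), X (s 2) != X (s 0) & X (s 1) != X (s 2)].
Proof.
move=> hs0 T0 dX; have nX := immersed_near T0 dX.
have nab : \forall h \near 0^', a < h + s0 < b.
  apply: nbhs_dnbhs; have : (h + s0 @[h --> (0 : R)] --> s0).
    by rewrite -[X in _ --> X]add0r; apply: cvgD; [exact: cvg_id|exact: cvg_cst].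
  by move=> cs; exact: (cs _ (near_itv hs0)).
have [h1 [h1X h1ab]] : exists h, X (h + s0) != X s0 /\ a < h + s0 < b.
  by apply: (@filter_ex _ (0^' : set_system R)); near=> h; split; near: h.
have cX : X (h + s0) @[h --> 0^'] --> X s0.
  have := is_derive_continuous dX; rewrite /continuous_at => cX.
  have cs : h + s0 @[h --> (0 : R)^'] --> s0.
    rewrite -[X in _ --> X]add0r; apply: cvgD; last exact: cvg_cst.
    exact: cvg_within.
  exact: (cvg_comp _ _ cs cX).
have h1n : \forall h \near 0^', X (h1 + s0) != X (h + s0).
  have : X (h1 + s0) - X (h + s0) @[h --> 0^'] --> X (h1 + s0) - X s0.
    by apply: cvgB => //; exact: cvg_cst.
  move=> /cvgr_neq0; rewrite subr_eq0 => /(_ h1X).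
  by apply: filterS => h; rewrite subr_eq0.
have [h2 [h2X h2ab h12]] : exists h,
    [/\ X (h + s0) != X s0, a < h + s0 < b & X (h1 + s0) != X (h + s0)].
  by apply: (@filter_ex _ (0^' : set_system R)); near=> h; split; near: h.
exists (fun i : 'I_3 => nth s0 [:: s0; h1 + s0; h2 + s0] i); split.
  by case=> [[|[|[|//]]]].
by split.
Unshelve. all: by end_near. Qed.

End Distinct.

(** * Patches of a linear Weingarten surface along a curvature line foliation *)
Section CircleDerivatives.
Variable R : realType.
Implicit Types (u v w : R -> 'rV[R]_3).

Lemma is_derive_sqrt (f : R -> R) (t df : R) : 0 < f t -> is_derive t 1 f df ->
  exists d, is_derive t 1 (fun s => Num.sqrt (f s)) d.
Proof.
by move=> f0 hf; eexists; apply: (is_derive_comp (is_derive1_sqrt f0) hf).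
Qed.

Lemma is_derive_axis3 u v w (t : R) du dv dw :
  is_derive t 1 u du -> is_derive t 1 v dv -> is_derive t 1 w dw ->
  exists d, is_derive t 1 (fun s => axis3 (u s) (v s) (w s)) d.
Proof.
move=> hu hv hw; eexists.
exact: (is_derive_cross (is_derive_sub hv hu) (is_derive_sub hw hu)).
Qed.

Lemma is_derive_unit_axis3 u v w (t : R) du dv dw :
  is_derive t 1 u du -> is_derive t 1 v dv -> is_derive t 1 w dw ->
  axis3 (u t) (v t) (w t) != 0 ->
  exists d, is_derive t 1 (fun s => unit_axis3 (u s) (v s) (w s)) d.
Proof.
move=> hu hv hw a0; have [da ha] := is_derive_axis3 hu hv hw.
have [ds hs] := is_derive_sqrt (dot_gt0 a0) (is_derive_dot ha ha).
eexists; apply: (is_derive_scale (is_derive_inv _ hs) ha).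
by rewrite gt_eqF// sqrtr_gt0 dot_gt0.
Qed.

Lemma is_derive_centre3 u v w (t : R) du dv dw :
  is_derive t 1 u du -> is_derive t 1 v dv -> is_derive t 1 w dw ->
  axis3 (u t) (v t) (w t) != 0 ->
  exists d, is_derive t 1 (fun s => centre3 (u s) (v s) (w s)) d.
Proof.
move=> hu hv hw a0; have [da ha] := is_derive_axis3 hu hv hw.
have hv' := is_derive_sub hv hu; have hw' := is_derive_sub hw hu.
have a2 : 2 * dot (axis3 (u t) (v t) (w t)) (axis3 (u t) (v t) (w t)) != 0.
  by rewrite mulf_neq0// gt_eqF// dot_gt0.
have h2 := is_derive_inv (f := fun s => 2 * dot (axis3 (u s) (v s) (w s))
  (axis3 (u s) (v s) (w s))) a2
  (is_derive_mul (is_derive_cst (2 : R) t 1) (is_derive_dot ha ha)).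
have h1 := is_derive_add (is_derive_scale (is_derive_dot hv' hv') (is_derive_cross hw' ha))
  (is_derive_scale (is_derive_dot hw' hw') (is_derive_cross ha hv')).
eexists; exact: (is_derive_add hu (is_derive_scale h2 h1)).
Qed.

Lemma is_derive_radius3 u v w (t : R) du dv dw :
  is_derive t 1 u du -> is_derive t 1 v dv -> is_derive t 1 w dw ->
  axis3 (u t) (v t) (w t) != 0 -> u t - centre3 (u t) (v t) (w t) != 0 ->
  exists d, is_derive t 1 (fun s => radius3 (u s) (v s) (w s)) d.
Proof.
move=> hu hv hw a0 r0; have [dc hc] := is_derive_centre3 hu hv hw a0.
have h := is_derive_sub hu hc.
exact: (is_derive_sqrt (dot_gt0 r0) (is_derive_dot h h)).
Qed.

End CircleDerivatives.

Section Patch.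
Variable R : realType.
Variables (a b c a0 b0 a1 b1 : R).

(** A rectangle in which the lines t = const are curvature lines with principal
    curvature kappa; lam is the other principal curvature, and the derivative of
    the normal is triangular because only the first coordinate lines are known
    to be principal. *)
Record lw_patch (X N Xs Xt Nt : R -> R -> 'rV[R]_3) (kappa lam : R -> R -> R) :
  Prop := LWPatch {
  patch_Xs : forall s t, a0 < s < b0 -> a1 < t < b1 ->
    is_derive s 1 (X^~ t) (Xs s t);
  patch_Xt : forall s t, a0 < s < b0 -> a1 < t < b1 ->
    is_derive t 1 (X s) (Xt s t);
  patch_Ns : forall s t, a0 < s < b0 -> a1 < t < b1 ->
    is_derive s 1 (N^~ t) (- kappa s t *: Xs s t);
  patch_Nt : forall s t, a0 < s < b0 -> a1 < t < b1 ->
    is_derive t 1 (N s) (Nt s t);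
  patch_Xt_continuous : forall s t, a0 < s < b0 -> a1 < t < b1 ->
    {for t, continuous (Xt s)};
  patch_independent : forall s t, a0 < s < b0 -> a1 < t < b1 ->
    cross (Xs s t) (Xt s t) != 0;
  patch_NN : forall s t, a0 < s < b0 -> a1 < t < b1 -> dot (N s t) (N s t) = 1;
  patch_NXs : forall s t, a0 < s < b0 -> a1 < t < b1 -> dot (N s t) (Xs s t) = 0;
  patch_NXt : forall s t, a0 < s < b0 -> a1 < t < b1 -> dot (N s t) (Xt s t) = 0;
  patch_shape : forall s t, a0 < s < b0 -> a1 < t < b1 ->
    exists tau, Nt s t + lam s t *: Xt s t = tau *: Xs s t;
  patch_weingarten : forall s t, a0 < s < b0 -> a1 < t < b1 ->
    a * (kappa s t * lam s t) + b * (kappa s t + lam s t) + c = 0 }.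

Hypothesis discriminant_neq0 : discriminant a b c != 0.

Variables (X N Xs Xt Nt : R -> R -> 'rV[R]_3) (kappa lam : R -> R -> R).
Hypothesis P : lw_patch X N Xs Xt Nt kappa lam.

(** If a k + b = 0, the relation also forces b k + c = 0, and then b^2 = a c. *)
Lemma weingarten_slope k l : a * (k * l) + b * (k + l) + c = 0 -> a * k + b != 0.
Proof.
move=> h; apply/eqP => h0; case/eqP: discriminant_neq0; rewrite /discriminant.
have -> : b ^+ 2 - a * c = (b + a * l) * (a * k + b)
    - a * (a * (k * l) + b * (k + l) + c) by ring.
by rewrite h0 h !mulr0 subr0.
Qed.

Lemma patch_Xs_neq0 s t : a0 < s < b0 -> a1 < t < b1 -> Xs s t != 0.
Proof.
move=> hs ht; apply: contraNneq (patch_independent P hs ht) => ->.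
by apply/eqP/cross0l.
Qed.

Definition circular_leaf t C B r :=
  [/\ 0 < r, dot B B = 1 & forall s, a0 < s < b0 -> on_circle C B r (X s t)].

Lemma patch_leaf s0 t C B r : a0 < s0 < b0 -> a1 < t < b1 ->
  circular_leaf t C B r ->
  let k := - (dot (N s0 t) (X s0 t - C) / r ^+ 2) in
  let q := dot (N s0 t) B in
  forall s, a0 < s < b0 -> [/\ N s t = - k *: (X s t - C) + q *: B, kappa s t = k,
    dot (Xs s t) (X s t - C) = 0 & dot (Xs s t) B = 0].
Proof.
move=> hs0 ht [r0 BB hC] k q s hs.
have H u : a0 < u < b0 -> [/\ on_circle C B r (X u t),
    is_derive u 1 (X^~ t) (Xs u t), is_derive u 1 (N^~ t) (- kappa u t *: Xs u t),
    Xs u t != 0 & dot (N u t) (Xs u t) = 0].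
  move=> hu; split; [exact: hC|exact: (patch_Xs P)|exact: (patch_Ns P)| |].
    exact: patch_Xs_neq0.
  exact: (patch_NXs P).
have [e1 e2] := leaf_normal hs0 r0 BB H hs.
have hn : \forall u \near s, on_circle C B r (X u t).
  by apply: filterS (near_itv hs) => u; exact: hC.
by have [] := circle_tangent hn (patch_Xs P hs ht).
Qed.

(** The quadratic factor vanishes exactly when the second principal curvature
    determined by k is k itself; the factor r^2 makes the product constant
    across the leaves. *)
Definition first_integral k r := r ^+ 2 * (a * k ^+ 2 + 2 * b * k + c).

End Patch.

Section PatchAxis.
Variable R : realType.
Variables (a b c a0 b0 a1 b1 : R).
Hypothesis discriminant_neq0 : discriminant a b c != 0.
Variables (X N Xs Xt Nt : R -> R -> 'rV[R]_3) (kappa lam : R -> R -> R).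
Hypothesis P : lw_patch a b c a0 b0 a1 b1 X N Xs Xt Nt kappa lam.

Local Notation Q := (first_integral a b c).
Local Notation circular_leaf := (circular_leaf a0 b0 X).

Lemma constant_near_row n (f : R -> 'rV[R]_n.+1) (t0 : R) :
  (\forall t \near t0, is_derive (t : R) 1 f 0) -> \forall t \near t0, f t = f t0.
Proof.
move=> H; near=> t; apply/rowP => i; move: i; near: t; apply: filter_forall => i.
apply: (constant_near (f := fun t => f t 0 i)).
by apply: filterS H => t /is_derive_rowP/(_ i); rewrite mxE.
Unshelve. all: by end_near. Qed.

Lemma circular_leafN t C B r : circular_leaf t C B r -> circular_leaf t C (- B) r.
Proof.
move=> [r0 BB hC]; split=> //; first by rewrite !dotL BB opprK.
by move=> s hs; have [h1 h2] := hC s hs; split; rewrite // dotNr h2 oppr0.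
Qed.

(* The circle of each leaf t near a given one is recovered from the points with
   first coordinates s 0, s 1, s 2; the leaves on which these points are not
   collinear are the good ones. *)
Section Point.
Variable s : 'I_3 -> R.
Hypothesis hs : forall i, a0 < s i < b0.
Hypothesis circular : forall t, a1 < t < b1 -> exists C B r, circular_leaf t C B r.

Let A t := axis3 (X (s 0) t) (X (s 1) t) (X (s 2) t).
Let B t := unit_axis3 (X (s 0) t) (X (s 1) t) (X (s 2) t).
Let C t := centre3 (X (s 0) t) (X (s 1) t) (X (s 2) t).
Let r t := radius3 (X (s 0) t) (X (s 1) t) (X (s 2) t).
Let k t := - (dot (N (s 0) t) (X (s 0) t - C t) / r t ^+ 2).
Let q t := dot (N (s 0) t) (B t).
Let good t := a1 < t < b1 /\ A t != 0.

Lemma good_leaf t : good t -> circular_leaf t (C t) (B t) (r t).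
Proof.
move=> [ht At]; have [C' [B' [r' cl]]] := circular ht.
have [r0 BB h] := cl.
have [eC er [eB|eB]] := circle3 r0 BB (h _ (hs 0)) (h _ (hs 1)) (h _ (hs 2)) At.
  by rewrite /C /B /r -eC -er -eB.
have e : B t = - B' by rewrite eB opprK.
by rewrite e /C /r -eC -er; exact: circular_leafN.
Qed.

Lemma good_derive t : (\forall u \near t, good u) ->
  exists C' B' r' k' l,
  [/\ is_derive t 1 C C', is_derive t 1 B B', is_derive t 1 r r', is_derive t 1 k k'
    & [/\ a * (k t * l) + b * (k t + l) + c = 0, k' * r t + k t * r' = l * r'
      & k t != l -> B' = 0 /\ C' = dot C' (B t) *: B t]].
Proof.
move=> ngood; have gt : good t by exact: nbhs_singleton.
have [ht At] := gt; have cl := good_leaf gt; have [r0 BB hC] := cl.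
have dX i := patch_Xt P (hs i) ht; have dN i := patch_Nt P (hs i) ht.
have [C' dC] := is_derive_centre3 (dX 0) (dX 1) (dX 2) At.
have [B' dB] := is_derive_unit_axis3 (dX 0) (dX 1) (dX 2) At.
have [|r' dr] := is_derive_radius3 (dX 0) (dX 1) (dX 2) At.
  apply: contraTneq r0 => e; rewrite -/(r t).
  have [+ _] := hC _ (hs 0); rewrite e dot0l => /esym/eqP.
  by rewrite sqrf_eq0 => /eqP ->; rewrite ltxx.
rewrite -/C -/B -/r in dC dB dr.
have rt0 : r t ^+ 2 != 0 by rewrite expf_eq0/= gt_eqF.
have [k' dk] : exists k', is_derive t 1 k k'.
  have h := is_derive_sub (dX 0) dC.
  eexists; exact: (is_derive_opp (is_derive_mul (is_derive_dot (dN 0) h)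
    (is_derive_inv (f := fun u => r u ^+ 2) rt0 (is_derive_mul dr dr)))).
have [q' dq] : exists q', is_derive t 1 q q'.
  by eexists; exact: (is_derive_dot (dN 0) dB).
have leaf u : good u -> forall i, [/\ N (s i) u = - k u *: (X (s i) u - C u) + q u *: B u,
    kappa (s i) u = k u, dot (Xs (s i) u) (X (s i) u - C u) = 0
    & dot (Xs (s i) u) (B u) = 0].
  move=> gu i; have [hu _] := gu.
  exact: (patch_leaf P (hs 0) hu (good_leaf gu) (hs i)).
have slope : a * k t + b != 0.
  have [_ <- _ _] := leaf t gt 0.
  exact: (weingarten_slope discriminant_neq0 (patch_weingarten P (hs 0) ht)).
(* The second curvature at the three points, by the Weingarten relation. *)
pose l := - (b * k t + c) / (a * k t + b).
have lE i : lam (s i) t = l.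
  have := patch_weingarten P (hs i) ht; have [_ -> _ _] := leaf t gt i.
  by move=> h; apply: (mulIf slope); rewrite /l divfK//; lra.
have lw : a * (k t * l) + b * (k t + l) + c = 0.
  by rewrite -(lE 0); have [_ <- _ _] := leaf t gt 0; exact: (patch_weingarten P).
have B'B : dot B' (B t) = 0.
  have : dot B' (B t) + dot (B t) B' = 0.
    apply: (is_derive_near_unique _ (is_derive_dot dB dB) (is_derive_cst (1 : R) t 1)).
    by apply: filterS ngood => u /good_leaf[].
  by rewrite (dotC (B t)); lra.
have [|e1 _ _ e4] := @leaf_variation _ (C t) (B t) (r t) (k t) (q t) C' B' r' k' q' l
  (fun i => X (s i) t) (fun i => Xt (s i) t) (fun i => Nt (s i) t) r0 BB B'B At.
- move=> i /=; have dXC := is_derive_sub (dX i) dC.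
  have [Ne ke Xd XB] := leaf t gt i.
  split.
  + exact: hC.
  + have : dot (Xt (s i) t - C') (X (s i) t - C t) +
      dot (X (s i) t - C t) (Xt (s i) t - C') = r' * r t + r t * r'.
      apply: (is_derive_near_unique _ (is_derive_dot dXC dXC) (is_derive_mul dr dr)).
      by apply: filterS ngood => u gu; have [_ _ /(_ _ (hs i)) []] := good_leaf gu.
    by rewrite (dotC (X (s i) t - C t)); lra.
  + apply: (is_derive_near_unique _ (is_derive_dot dXC dB) (is_derive_cst (0 : R) t 1)).
    by apply: filterS ngood => u gu; have [_ _ /(_ _ (hs i)) []] := good_leaf gu.
  + rewrite -addrA -scaleNr; apply: (is_derive_near_unique _ (dN i) (is_derive_add
      (is_derive_scale (is_derive_opp dk) dXC) (is_derive_scale dq dB))).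
    by apply: filterS ngood => u gu; have [] := leaf u gu i.
  + have [tau e] := patch_shape P (hs i) ht; rewrite -(lE i) e !dotZl Xd XB mulr0.
    by split=> //; rewrite -Ne dotC; exact: (patch_NXt P).
- exists C', B', r', k', l; split=> //; split=> //.
Qed.

(** By (k r)' = l r', the derivative is 2 r r' times the Weingarten relation. *)
Lemma good_first_integral t0 : (\forall t \near t0, good t) ->
  \forall t \near t0, Q (k t) (r t) = Q (k t0) (r t0).
Proof.
move=> ngood; apply: (constant_near (f := fun t => Q (k t) (r t))).
have := near_join ngood; apply: filterS => t /good_derive.
move=> [C' [B' [r' [k' [l [dC dB dr dk [lw e _]]]]]]].
apply: (is_derive_val (is_derive_mul (is_derive_mul dr dr)
  (is_derive_add (is_derive_add
     (is_derive_mul (is_derive_cst a t 1) (is_derive_mul dk dk))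
     (is_derive_mul (is_derive_cst (2 * b) t 1) dk))
   (is_derive_cst c t 1)))).
rewrite /cst; transitivity (2 * r t * ((k' * r t + k t * r' - l * r') * (a * k t + b)
  + r' * (a * (k t * l) + b * (k t + l) + c))); first by ring.
by rewrite e lw; ring.
Qed.

(** A nonzero first integral means k <> l, so that B' = 0 and C' is parallel to
    B; the foot of the axis, C - <C, B> B, then has derivative zero. *)
Lemma good_axis t0 : (\forall t \near t0, good t) ->
  \forall t \near t0, Q (k t0) (r t0) != 0 -> B t = B t0 /\
    C t - dot (C t) (B t) *: B t = C t0 - dot (C t0) (B t0) *: B t0.
Proof.
move=> ngood; have [e|f0] := eqVneq (Q (k t0) (r t0)) 0.
  by near=> t; move=> /negP[]; apply/eqP.
have H : \forall t \near t0, exists C', [/\ is_derive (t : R) 1 C C', is_derive (t : R) 1 B 0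
    & C' = dot C' (B t) *: B t].
  near=> t; have : \forall u \near t, good u by near: t; exact: (near_join ngood).
  move=> /good_derive[C' [B' [r' [k' [l [dC dB dr dk [lw _ e]]]]]]].
  have kl : k t != l.
    apply: contraNneq f0 => kl.
    have <- : Q (k t) (r t) = Q (k t0) (r t0).
      by near: t; exact: good_first_integral.
    rewrite /first_integral; apply/eqP; transitivity (r t ^+ 2 * 0); last exact: mulr0.
    by congr (_ * _); rewrite -[RHS]lw -kl; ring.
  by exists C'; have [<- <-] := e kl.
have H1 : \forall t \near t0, B t = B t0.
  by apply: constant_near_row; apply: filterS H => t [C' []].
have H2 : \forall t \near t0,
    C t - dot (C t) (B t) *: B t = C t0 - dot (C t0) (B t0) *: B t0.
  apply: (constant_near_row (f := fun t => C t - dot (C t) (B t) *: B t)).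
  apply: filterS H => t [C' [dC dB e]].
  apply: (is_derive_val (is_derive_sub dC (is_derive_scale (is_derive_dot dC dB) dB))).
  by rewrite (dotC _ 0) dot0l addr0 scaler0 addr0 {1}e subrr.
by apply: filterS2 H1 H2 => t.
Unshelve. all: by end_near. Qed.

End Point.

(** The form of the previous lemmas that no longer mentions the three points. *)
Lemma patch_axis s0 t0 : a0 < s0 < b0 -> a1 < t0 < b1 ->
  (forall t, a1 < t < b1 -> exists C B r, circular_leaf t C B r) ->
  exists (C B : R -> 'rV[R]_3) (r k : R -> R), \forall t \near t0,
  [/\ a1 < t < b1, circular_leaf t (C t) (B t) (r t),
     (forall s, a0 < s < b0 -> kappa s t = k t),
     Q (k t) (r t) = Q (k t0) (r t0)
   & Q (k t0) (r t0) != 0 -> B t = B t0 /\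
    C t - dot (C t) (B t) *: B t = C t0 - dot (C t0) (B t0) *: B t0].
Proof.
move=> hs0 ht0 hc.
have [s [hs [s10 s20 s12]]] := three_points hs0 (patch_Xs_neq0 P hs0 ht0)
  (patch_Xs P hs0 ht0).
pose A t := axis3 (X (s 0) t) (X (s 1) t) (X (s 2) t).
have A0 : A t0 != 0.
  have [C [B [r [r0 BB h]]]] := hc _ ht0.
  exact: (axis3_neq0 (h _ (hs 0)) (h _ (hs 1)) (h _ (hs 2)) s10 s20 s12).
have nA : \forall t \near t0, A t != 0.
  have [dA /is_derive_continuous hA] := is_derive_axis3 (patch_Xt P (hs 0) ht0)
    (patch_Xt P (hs 1) ht0) (patch_Xt P (hs 2) ht0).
  by move: hA => /cvgr_neq0; exact.
have ngood : \forall t \near t0, a1 < t < b1 /\ A t != 0.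
  by apply: filterS2 (near_itv ht0) nA.
exists (fun t => centre3 (X (s 0) t) (X (s 1) t) (X (s 2) t)),
  (fun t => unit_axis3 (X (s 0) t) (X (s 1) t) (X (s 2) t)),
  (fun t => radius3 (X (s 0) t) (X (s 1) t) (X (s 2) t)),
  (fun t => - (dot (N (s 0) t) (X (s 0) t - centre3 (X (s 0) t) (X (s 1) t) (X (s 2) t)) / radius3 (X (s 0) t) (X (s 1) t) (X (s 2) t) ^+ 2)).
have h1 := good_first_integral hs hc ngood.
have h2 := good_axis hs hc ngood.
near=> t; have gt : a1 < t < b1 /\ A t != 0 by near: t.
have cl := good_leaf hs hc gt; have [ht _] := gt.
split; [exact: ht|exact: cl| | |].
- by move=> s' hs'; have [_ -> _ _] := patch_leaf P (hs 0) ht cl hs'.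
- by near: t; exact: h1.
- by near: t; exact: h2.
Unshelve. all: by end_near. Qed.

End PatchAxis.

(** * The profile equations *)
Section ContinuousDot.
Variable R : realType.

Lemma continuous_dot (T : topologicalType) (f g : T -> 'rV[R]_3) (t : T) :
  {for t, continuous f} -> {for t, continuous g} ->
  {for t, continuous (fun s => dot (f s) (g s))}.
Proof.
move=> cf cg; suff : dot (f s) (g s) @[s --> t] --> dot (f t) (g t) by [].
have c (i : 'I_3) (e : T -> 'rV[R]_3) : {for t, continuous e} ->
    e x 0 i @[x --> t] --> e t 0 i.
  by move=> ce; apply: (cvg_comp e (fun v => v 0 i) ce); exact: coord_continuous.
under eq_fun do rewrite dotE; rewrite dotE.
by apply: cvgD; [apply: cvgD|]; apply: cvgM; exact: c.
Qed.

End ContinuousDot.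

Section State.
Variable R : realType.
Variables (a b c : R).

Definition row4 (r h p q : R) : 'rV[R]_4 := \row_i nth 0 [:: r; h; p; q] i.

Lemma row4E r h p q : (row4 r h p q 0 0 = r) * (row4 r h p q 0 1 = h)
  * (row4 r h p q 0 2 = p) * (row4 r h p q 0 3 = q).
Proof. by rewrite !mxE. Qed.

Lemma row4P (u v : 'rV[R]_4) : u 0 0 = v 0 0 -> u 0 1 = v 0 1 ->
  u 0 2 = v 0 2 -> u 0 3 = v 0 3 -> u = v.
Proof.
move=> e0 e1 e2 e3; apply/rowP => -[[|[|[|[|//]]]] hi].
- by rewrite (_ : Ordinal hi = 0)//; apply/val_inj.
- by rewrite (_ : Ordinal hi = 1)//; apply/val_inj.
- by rewrite (_ : Ordinal hi = 2)//; apply/val_inj.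
- by rewrite (_ : Ordinal hi = 3)//; apply/val_inj.
Qed.

(** The profile satisfies r' = q, h' = p, p' = lam q, q' = - lam p in arc length,
    with lam = - (b p + c r) / (a p + b r) by the Weingarten relation, since
    p = kappa r.  Multiplying by the denominator only changes the parameter and
    makes the field polynomial, hence its integral curves smooth. *)
Definition profile_field (y : 'rV[R]_4) : 'rV[R]_4 :=
  let r := y 0 0 in let p := y 0 2 in let q := y 0 3 in
  row4 (q * (a * p + b * r)) (p * (a * p + b * r))
       (- q * (b * p + c * r)) (p * (b * p + c * r)).

Variables (o B : 'rV[R]_3).

Definition axis_height (x : 'rV[R]_3) : R := dot (x - o) B.
Definition axis_radial (x : 'rV[R]_3) : 'rV[R]_3 := x - (o + axis_height x *: B).
Definition axis_radius (x : 'rV[R]_3) : R := Num.sqrt (dot (axis_radial x) (axis_radial x)).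
(** Radius and height of a point with respect to the axis o + R B, and the
    components of the normal towards the axis and along it. *)
Definition profile_state (x n : 'rV[R]_3) : 'rV[R]_4 :=
  row4 (axis_radius x) (axis_height x) (- (dot n (axis_radial x) / axis_radius x)) (dot n B).

Variables (a0 b0 a1 b1 : R).
Hypothesis discriminant_neq0 : discriminant a b c != 0.
Variables (X N Xs Xt Nt : R -> R -> 'rV[R]_3) (kappa lam : R -> R -> R).
Hypothesis P : lw_patch a b c a0 b0 a1 b1 X N Xs Xt Nt kappa lam.
Hypothesis BB : dot B B = 1.
Hypothesis leaves : forall t, a1 < t < b1 ->
  exists h r, circular_leaf a0 b0 X t (o + h *: B) B r.

(** The circle of a leaf is determined by any of its points and the axis. *)
Lemma patch_circle s t : a0 < s < b0 -> a1 < t < b1 ->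
  [/\ 0 < axis_radius (X s t), dot (axis_radial (X s t)) B = 0
    & circular_leaf a0 b0 X t (o + axis_height (X s t) *: B) B (axis_radius (X s t))].
Proof.
move=> hs ht; have [h [r cl]] := leaves ht; have [r0 _ hC] := cl.
have [e1 e2] := hC s hs.
have eh : axis_height (X s t) = h.
  by move: e2; rewrite opprD addrA dotDl dotNl dotZl BB mulr1 /axis_height; lra.
have er : axis_radius (X s t) = r.
  by rewrite /axis_radius /axis_radial eh e1 sqrtr_sqr gtr0_norm.
by rewrite eh er /axis_radial eh.
Qed.

Lemma patch_state_const s s' t : a0 < s < b0 -> a0 < s' < b0 -> a1 < t < b1 ->
  profile_state (X s t) (N s t) = profile_state (X s' t) (N s' t).
Proof.
move=> hs hs' ht; have [r0 dB cl] := patch_circle hs ht.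
have [_ _ hC] := cl; have [e1 e2] := hC s' hs'.
have eh : axis_height (X s' t) = axis_height (X s t).
  by move: e2; rewrite opprD addrA dotDl dotNl dotZl BB mulr1 /axis_height; lra.
have er : axis_radius (X s' t) = axis_radius (X s t).
  by rewrite {1}/axis_radius /axis_radial eh e1 sqrtr_sqr gtr0_norm.
have /= [-> _ _ _] := patch_leaf P hs ht cl hs'.
rewrite /profile_state er eh; congr (row4 _ _ _ _).
- rewrite /axis_radial eh.
  rewrite [in RHS]dotDl !dotZl e1 (dotC B) e2 mulr0 addr0.
  by field; rewrite gt_eqF.
- by rewrite dotDl !dotZl e2 BB; ring.
Qed.

(** With p^2 + q^2 = 1 the relation p r' = q h' means (r', h') = sig (q, p) for
    sig = q r' + p h', and g is sig divided by a p + b r.  If sig vanished, x_t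
    would be orthogonal to both the radius and the axis, hence parallel to x_s. *)
Lemma patch_state_derive s : a0 < s < b0 -> exists g : R -> R,
  forall t, a1 < t < b1 -> let y := profile_state (X s t) (N s t) in
  [/\ is_derive t 1 (fun t => profile_state (X s t) (N s t)) (g t *: profile_field y),
    g t != 0, {for t, continuous g},
    y 0 2 ^+ 2 + y 0 3 ^+ 2 = 1 & a * y 0 2 + b * y 0 0 != 0].
Proof.
move=> hs.
pose d t := axis_radial (X s t); pose r t := axis_radius (X s t).
pose p t := - (dot (N s t) (d t) / r t); pose q t := dot (N s t) B.
exists (fun t => (q t * (dot (Xt s t) (d t) / r t) + p t * dot (Xt s t) B)
  / (a * p t + b * r t)) => t ht y.
have [r0 dB cl] := patch_circle hs ht; have [_ _ hC] := cl.
have dX := patch_Xt P hs ht; have dN := patch_Nt P hs ht.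
have NX := patch_NXt P hs ht; have NN := patch_NN P hs ht.
pose k := - (dot (N s t) (d t) / r t ^+ 2).
have [eN ek Xsd XsB] : [/\ N s t = - k *: d t + q t *: B, kappa s t = k,
    dot (Xs s t) (d t) = 0 & dot (Xs s t) B = 0] by exact: (patch_leaf P hs ht cl hs).
rewrite -/(d t) -/(r t) in r0 dB.
have dd : dot (d t) (d t) = r t ^+ 2 by rewrite sqr_sqrtr// dot_ge0.
have pE : p t = k * r t by rewrite /p /k; field; rewrite gt_eqF.
have slope : a * k + b != 0.
  by rewrite -ek; exact: (weingarten_slope discriminant_neq0 (patch_weingarten P hs ht)).
have P0 : a * p t + b * r t != 0.
  rewrite pE mulrA -mulrDl mulf_neq0// gt_eqF//.
set l := lam s t; have lw : a * (k * l) + b * (k + l) + c = 0.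
  by rewrite -ek; exact: (patch_weingarten P).
have lE : l = - (b * p t + c * r t) / (a * p t + b * r t).
  apply: (mulIf P0); rewrite divfK// pE.
  by apply/eqP; rewrite -subr_eq0; apply/eqP; rewrite -[RHS](mulr0 (r t)) -lw; ring.
have [tau et] := patch_shape P hs ht; rewrite -/l in et.
set h' := dot (Xt s t) B; set r' := dot (Xt s t) (d t) / r t.
have dh : is_derive t 1 (fun t => axis_height (X s t)) h'.
  apply: (is_derive_val (is_derive_dot (is_derive_sub dX (is_derive_cst o t 1))
    (is_derive_cst B t 1))).
  by rewrite subr0 (dotC _ 0) dot0l addr0.
have ded : is_derive t 1 d (Xt s t - h' *: B).
  apply: (is_derive_val (is_derive_sub dX (is_derive_add (is_derive_cst o t 1)
    (is_derive_scale dh (is_derive_cst B t 1))))).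
  by rewrite scaler0 addr0 add0r.
have dd0 : 0 < dot (d t) (d t) by rewrite dd exprn_gt0.
have der : is_derive t 1 r r'.
  apply: (is_derive_val (is_derive_comp (is_derive1_sqrt dd0) (is_derive_dot ded ded))).
  have -> : Num.sqrt (dot (d t) (d t)) = r t by [].
  rewrite (dotC (d t)) dotDl dotNl dotZl (dotC B) dB /r'.
  by field; rewrite gt_eqF.
have deq : is_derive t 1 q (- l * h').
  apply: (is_derive_val (is_derive_dot dN (is_derive_cst B t 1))).
  rewrite (dotC _ 0) dot0l addr0; have : dot (tau *: Xs s t) B = 0 by rewrite dotZl XsB mulr0.
  by rewrite -et dotDl dotZl -/h'; lra.
have rr' : dot (Xt s t) (d t) = r t * r' by rewrite /r'; field; rewrite gt_eqF.
have Ntd : dot (Nt s t) (d t) = - l * (r t * r').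
  have : dot (tau *: Xs s t) (d t) = 0 by rewrite dotZl Xsd mulr0.
  by rewrite -et dotDl dotZl rr'; lra.
have pr : p t * r' = q t * h'.
  rewrite pE; move: NX; rewrite {1}eN dotDl !dotZl (dotC (d t)) (dotC B) rr' -/h'; lra.
have Nd : dot (N s t) (d t) = - (p t * r t).
  by rewrite /p; field; rewrite gt_eqF.
have dep : is_derive t 1 p (l * r').
  have r0' : r t != 0 by rewrite gt_eqF.
  apply: (is_derive_val (is_derive_opp (is_derive_mul (is_derive_dot dN ded)
    (is_derive_inv r0' der)))).
  rewrite Ntd Nd dotDr dotNr dotZr NX -/(q t).
  transitivity (l * r' + (q t * h' - p t * r') / r t); first by field.
  by rewrite pr subrr mul0r addr0.
have pq : p t ^+ 2 + q t ^+ 2 = 1.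
  by rewrite -NN eN dotDl !dotDr !dotZl !dotZr dd (dotC B) dB BB pE; ring.
set sig := q t * r' + p t * h'.
have er' : r' = q t * sig.
  transitivity (r' * (p t ^+ 2 + q t ^+ 2)); first by rewrite pq mulr1.
  transitivity (p t * (p t * r') + q t ^+ 2 * r'); first by ring.
  by rewrite pr /sig; ring.
have eh' : h' = p t * sig.
  transitivity (h' * (p t ^+ 2 + q t ^+ 2)); first by rewrite pq mulr1.
  transitivity (q t * (q t * h') + p t ^+ 2 * h'); first by ring.
  by rewrite -pr /sig; ring.
have yE : y = row4 (r t) (axis_height (X s t)) (p t) (q t) by [].
split.
- rewrite /profile_field yE !row4E.
  apply/is_derive_rowP => -[[|[|[|[|//]]]] hi]; rewrite !mxE /=.
  + apply: (is_derive_val (near_eq_is_derive _ der)).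
      by near=> u; rewrite mxE.
    by rewrite er'; field.
  + apply: (is_derive_val (near_eq_is_derive _ dh)).
      by near=> u; rewrite mxE.
    by rewrite eh'; field.
  + apply: (is_derive_val (near_eq_is_derive _ dep)).
      by near=> u; rewrite mxE.
    by rewrite lE er'; field.
  + apply: (is_derive_val (near_eq_is_derive _ deq)).
      by near=> u; rewrite mxE.
    by rewrite lE eh'; field.
- rewrite mulf_neq0 ?invr_eq0//; apply/eqP => sig0.
  rewrite sig0 mulr0 in er'; rewrite sig0 mulr0 in eh'.
  have Xtd : dot (Xt s t) (d t) = 0 by rewrite rr' er' mulr0.
  have Xs0 := patch_Xs_neq0 P hs ht.
  have e : Xt s t - (dot (Xs s t) (Xt s t) / dot (Xs s t) (Xs s t)) *: Xs s t = 0.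
    apply: (orth_frame (cross_neq0_orth r0 BB dd dB) Xs0 Xsd XsB).
    - by rewrite dotDl dotNl dotZl (dotC (Xt s t)); field; rewrite gt_eqF// dot_gt0.
    - by rewrite dotDl dotNl dotZl Xtd Xsd mulr0 subrr.
    - by rewrite dotDl dotNl dotZl -/h' eh' XsB mulr0 subrr.
  move/eqP: e; rewrite subr_eq0 => /eqP e.
  have := patch_independent P hs ht; rewrite e.
  move/eqP; apply; apply: row3P; rewrite /cross !mxE /=; ring.
- have [cr cq cp] : [/\ {for t, continuous r}, {for t, continuous q} &
      {for t, continuous p}] by split; apply: is_derive_continuous; eassumption.
  have cX := patch_Xt_continuous P hs ht; have cd := is_derive_continuous ded.
  apply: cvgM; last first.
    apply: cvgV => //; apply: cvgD; apply: cvgM => //; exact: cvg_cst.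
  apply: cvgD; apply: cvgM => //.
    apply: cvgM; first exact: continuous_dot.
    by apply: cvgV => //; rewrite gt_eqF.
  by apply: continuous_dot => //; exact: cvg_cst.
- by rewrite yE !row4E.
- by rewrite yE !row4E.
Unshelve. all: by end_near. Qed.

End State.

(** * Uniqueness of integral curves *)
Section Gronwall.
Variable R : realType.

(** The function f(x) exp(e x) is monotone for e = - K and for e = K, which
    handles the points to the right and to the left of s. *)
Lemma gronwall (f df : R -> R) (K s t : R) :
  (forall x, Num.min s t <= x <= Num.max s t ->
    [/\ is_derive x 1 f (df x), 0 <= f x & `|df x| <= K * f x]) ->
  f s = 0 -> f t = 0.
Proof.
move=> H fs0.
have h (e x : R) : Num.min s t <= x <= Num.max s t ->
    is_derive x 1 (fun x => f x * expR (e * x)) ((df x + e * f x) * expR (e * x)).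
  move=> /H[d _ _].
  apply: (is_derive_val (is_derive_mul d (is_derive_comp (is_derive_expR (e * x))
    (is_derive_mul (is_derive_cst e x 1) (is_derive_id x 1))))).
  by rewrite /cst; ring.
have wc (e : R) : {within `[Num.min s t, Num.max s t],
    continuous (fun x => f x * expR (e * x))}.
  by apply: derivable_within_continuous => x; rewrite in_itv/= => /(h e) [].
have st : Num.min s t <= Num.max s t.
  by rewrite ge_min !le_max lexx.
have ft : 0 <= f t.
  by have [|] := H t; rewrite ?ge_min ?le_max ?lexx ?orbT.
apply/eqP; rewrite eq_le ft andbT.
have dom x : x \in `]Num.min s t, Num.max s t[ -> Num.min s t <= x <= Num.max s t.
  by rewrite in_itv/= => /andP[? ?]; rewrite !ltW.
have key (e : R) : (s <= t -> e = - K) -> (t <= s -> e = K) -> f t <= 0.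
  move=> e1 e2.
  have [x hx] := MVT_segment st (fun x hx => h e x (dom x hx)) (wc e).
  move: hx; rewrite in_itv/= => /H[_ fx]; rewrite ler_norml => /andP[lo hi] E.
  rewrite -(pmulr_lle0 _ (expR_gt0 (e * t))).
  case/orP: (le_total s t) => le_st.
    move: E; rewrite (min_idPl le_st) (max_idPr le_st) fs0 mul0r subr0 => ->.
    rewrite mulr_le0_ge0 ?subr_ge0// mulr_le0_ge0 ?expR_ge0//.
    by rewrite (e1 le_st); lra.
  move: E; rewrite (min_idPr le_st) (max_idPl le_st) fs0 mul0r sub0r => E.
  rewrite -oppr_ge0 E mulr_ge0 ?subr_ge0// mulr_ge0 ?expR_ge0//.
  by rewrite (e2 le_st); lra.
case: (ltgtP s t) => st'.
- by apply: (key (- K)) => // ts; move: (lt_le_trans st' ts); rewrite ltxx.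
- by apply: (key K) => // ts; move: (lt_le_trans st' ts); rewrite ltxx.
- by rewrite -st' fs0.
Qed.

(** A difference of products splits as y y' - z z' = (y - z) y' + z (y' - z'), so
    this bounds every term of [sqdist_slope]. *)
Lemma quadratic_bound (M S d e f y z : R) : `|y| <= M -> `|z| <= M ->
  d ^+ 2 <= S -> e ^+ 2 <= S -> f ^+ 2 <= S ->
  `|2 * d * (e * y + z * f)| <= 4 * M * S.
Proof.
move=> hy hz hd he hf.
have M0 : 0 <= M by apply: le_trans hy.
have aux x w : `|w| <= M -> x ^+ 2 <= S -> `|2 * d * (x * w)| <= 2 * M * S.
  move=> hw hx; rewrite (_ : 2 * d * (x * w) = (2 * (d * x)) * w); last by ring.
  rewrite normrM (mulrC 2 M) -mulrA mulrC; apply: ler_pM => //.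
  by rewrite ler_norml; apply/andP; split; have := sqr_ge0 (d + x); have := sqr_ge0 (d - x); nra.
rewrite mulrDr (le_trans (ler_normD _ _))// (_ : 4 * M * S = 2 * M * S + 2 * M * S).
  by apply: lerD; [exact: aux|rewrite (mulrC z); exact: aux].
by ring.
Qed.

End Gronwall.

Section Profile.
Variable R : realType.
Variables (a b c : R).
Local Notation F := (profile_field a b c).

Definition sqdist (y z : 'rV[R]_4) : R :=
  (y 0 0 - z 0 0) ^+ 2 + (y 0 1 - z 0 1) ^+ 2
  + (y 0 2 - z 0 2) ^+ 2 + (y 0 3 - z 0 3) ^+ 2.

(** The derivative of the squared distance of two integral curves. *)
Definition sqdist_slope (y z : 'rV[R]_4) : R :=
  2 * (y 0 0 - z 0 0) * (F y 0 0 - F z 0 0)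
  + 2 * (y 0 1 - z 0 1) * (F y 0 1 - F z 0 1)
  + 2 * (y 0 2 - z 0 2) * (F y 0 2 - F z 0 2)
  + 2 * (y 0 3 - z 0 3) * (F y 0 3 - F z 0 3).

Lemma sqdist_eq0 y z : sqdist y z = 0 -> y = z.
Proof.
move=> /eqP; rewrite /sqdist !paddr_eq0 ?addr_ge0 ?sqr_ge0// !sqrf_eq0 !subr_eq0.
by move=> /andP[/andP[/andP[/eqP ? /eqP ?] /eqP ?] /eqP ?]; exact: row4P.
Qed.

Lemma profile_field_lipschitz (M : R) (y z : 'rV[R]_4) :
  (forall i, `|y 0 i| <= M) -> (forall i, `|z 0 i| <= M) ->
  `|sqdist_slope y z| <= 4 * M * (2 * `|a| + 4 * `|b| + 2 * `|c|) * sqdist y z.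
Proof.
move=> hy hz; set S := sqdist y z.
pose d i := y 0 i - z 0 i.
have hS i : d i ^+ 2 <= S.
  have := sqr_ge0 (d 0); have := sqr_ge0 (d 1); have := sqr_ge0 (d 2).
  have := sqr_ge0 (d 3); rewrite /S /sqdist -/(d 0) -/(d 1) -/(d 2) -/(d 3).
  case: i => -[|[|[|[|//]]]] hi.
  - by rewrite (_ : Ordinal hi = 0); [lra|exact/val_inj].
  - by rewrite (_ : Ordinal hi = 1); [lra|exact/val_inj].
  - by rewrite (_ : Ordinal hi = 2); [lra|exact/val_inj].
  - by rewrite (_ : Ordinal hi = 3); [lra|exact/val_inj].
pose B (i j k : 'I_4) := 2 * d i * (d j * y 0 k + z 0 j * d k).
have hB k i j l : `|k * B i j l| <= `|k| * (4 * M * S).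
  by rewrite normrM ler_wpM2l//; apply: quadratic_bound.
have -> : sqdist_slope y z = a * B 0 3 2 + b * B 0 3 0 + a * B 1 2 2 + b * B 1 2 0
   + (- b) * B 2 3 2 + (- c) * B 2 3 0 + b * B 3 2 2 + c * B 3 2 0.
  by rewrite /sqdist_slope /profile_field /B /d !row4E; ring.
have E : 4 * M * (2 * `|a| + 4 * `|b| + 2 * `|c|) * S = `|a| * (4 * M * S)
   + `|b| * (4 * M * S) + `|a| * (4 * M * S) + `|b| * (4 * M * S)
   + `|- b| * (4 * M * S) + `|- c| * (4 * M * S) + `|b| * (4 * M * S)
   + `|c| * (4 * M * S) by rewrite !normrN; ring.
by rewrite E; do 7! (apply: le_trans (ler_normD _ _) _; apply: lerD; last exact: hB).
Qed.

(** The second condition makes the plane curve (r, h) regular along the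
    field. *)
Definition regular_state (y : 'rV[R]_4) :=
  y 0 2 ^+ 2 + y 0 3 ^+ 2 = 1 /\ a * y 0 2 + b * y 0 0 != 0.

Definition integral_curve (l u : R) (y : R -> 'rV[R]_4) :=
  forall t, l < t < u -> is_derive t 1 y (F (y t)) /\ regular_state (y t).

Lemma is_derive_sqdist (y z : R -> 'rV[R]_4) (t : R) :
  is_derive t 1 y (F (y t)) -> is_derive t 1 z (F (z t)) ->
  is_derive t 1 (fun t => sqdist (y t) (z t)) (sqdist_slope (y t) (z t)).
Proof.
move=> /is_derive_rowP hy /is_derive_rowP hz.
have D i := is_derive_sub (hy i) (hz i); have D2 i := is_derive_mul (D i) (D i).
apply: (is_derive_val (is_derive_add (is_derive_add (is_derive_add
  (D2 0) (D2 1)) (D2 2)) (D2 3))).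
by rewrite /sqdist_slope; ring.
Qed.

(** The field is quadratic, hence Lipschitz on bounded sets, and both curves are
    bounded on the segment from t0 to t; so the squared distance satisfies the
    inequality of [gronwall]. *)
Lemma integral_curve_unique (l u t0 : R) y z : l < t0 < u ->
  integral_curve l u y -> integral_curve l u z -> y t0 = z t0 ->
  forall t, l < t < u -> y t = z t.
Proof.
move=> h0 hy hz e t ht; apply: sqdist_eq0.
set m := Num.min t0 t; set M := Num.max t0 t.
have inI x : m <= x <= M -> l < x < u.
  rewrite ge_min le_max => /andP[/orP[] h1 /orP[] h2]; lra.
have mM : m <= M by rewrite ge_min !le_max lexx.
pose g x := `|y x| + `|z x|.
have cg : {within `[m, M], continuous g}.
  apply: continuous_in_subspaceT => x; rewrite inE/= in_itv/= => /inI hx.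
  have [/is_derive_continuous cy _] := hy x hx.
  have [/is_derive_continuous cz _] := hz x hx.
  by apply: cvgD; [exact: (cvg_norm cy)|exact: (cvg_norm cz)].
have [x0 _ hb] := EVT_max mM cg.
apply: (@gronwall _ (fun t => sqdist (y t) (z t)) (fun t => sqdist_slope (y t) (z t))
  (4 * g x0 * (2 * `|a| + 4 * `|b| + 2 * `|c|)) t0).
  move=> x hx; have hxI := inI x hx; have [dy _] := hy x hxI; have [dz _] := hz x hxI.
  split; first exact: is_derive_sqdist.
    by rewrite !addr_ge0 ?sqr_ge0.
  have gx : g x <= g x0 by apply: hb; rewrite in_itv.
  have coord (v : 'rV[R]_4) i : `|v 0 i| <= `|v|.
    by rewrite /Num.Def.normr/= mx_normrE; apply: (le_bigmax _ _ (0, i)).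
  apply: profile_field_lipschitz => i; apply: (le_trans (coord _ i)).
    by apply: le_trans gx; rewrite lerDl.
  by apply: le_trans gx; rewrite lerDr.
by rewrite e /sqdist !subrr expr0n !addr0.
Qed.

Lemma integral_curve_sub l u l' u' y : l <= l' -> u' <= u ->
  integral_curve l u y -> integral_curve l' u' y.
Proof. by move=> ll uu hy t ht; apply: hy; lra. Qed.

Lemma integral_curve_near l u y z t : l < t < u -> integral_curve l u y ->
  (\forall s \near t, y s = z s) -> is_derive t 1 z (F (z t)) /\ regular_state (z t).
Proof.
move=> ht hy yz; have [dy ry] := hy t ht; rewrite -(nbhs_singleton yz).
by split=> //; apply: near_eq_is_derive yz dy.
Qed.

Lemma integral_curve_shift l u y d : integral_curve l u y ->
  integral_curve (l - d) (u - d) (fun t => y (t + d)).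
Proof.
move=> hy t ht; have [|dy ry] := hy (t + d); first lra.
split=> //; apply/is_derive_rowP => i; move/is_derive_rowP/(_ i) : dy => dy.
have dt : is_derive t 1 (fun t => t + d) (1 + 0).
  exact: (is_derive_add (is_derive_id t 1) (is_derive_cst d t 1)).
apply: (is_derive_val (is_derive_comp (f := fun t => y t 0 i) (g := fun t => t + d) dy dt)).
by rewrite addr0 mulr1.
Qed.

Lemma integral_curve_glue l u l' u' t1 y z : l < t1 < u -> l' < t1 < u' ->
  integral_curve l u y -> integral_curve l' u' z -> y t1 = z t1 ->
  exists w, [/\ integral_curve (Num.min l l') (Num.max u u') w,
    (forall t, l < t < u -> w t = y t) & (forall t, l' < t < u' -> w t = z t)].
Proof.
move=> h h' hy hz e; pose w t := if l < t < u then y t else z t.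
have wy t : l < t < u -> w t = y t by rewrite /w => ->.
have wz t : l' < t < u' -> w t = z t.
  rewrite /w; case: ifP => // ht ht'.
  have hm : forall t, l < t < u -> l' < t < u' ->
      Num.max l l' < t < Num.min u u'.
    by move=> s /andP[? ?] /andP[? ?]; rewrite gt_max lt_min; apply/andP; split; apply/andP.
  apply: (@integral_curve_unique (Num.max l l') (Num.min u u') t1) => //; try exact: hm.
    by apply: integral_curve_sub hy; rewrite ?le_max ?ge_min lexx.
  by apply: integral_curve_sub hz; rewrite ?le_max ?ge_min lexx ?orbT.
exists w; split=> // t; rewrite gt_min lt_max => ht.
have : l < t < u \/ l' < t < u'.
  move: ht => /andP[/orP[] h1 /orP[] h2]; case: (leP t t1) => h3; lra.
case=> {}ht.
  apply: (integral_curve_near ht hy); apply: filterS (near_itv ht) => s hs.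
  by rewrite wy.
apply: (integral_curve_near ht hz); apply: filterS (near_itv ht) => s hs.
by rewrite wz.
Qed.

End Profile.

(** * The maximal integral curve and its smoothness *)
Section MaximalCurve.
Variable R : realType.
Variables (a b c : R) (y0 : 'rV[R]_4).
Local Notation F := (profile_field a b c).
Local Notation integral_curve := (integral_curve a b c).

(** The union of all integral curves through y0 at time 0, well defined by
    uniqueness.  The local existence of solutions is not at stake: the surface
    provides the arcs that [max_curve_extend] adds. *)
Definition max_dom : set R := [set t | exists l u y,
  [/\ l < 0 < u, l < t < u, integral_curve l u y & y 0 = y0]].

Definition max_curve (t : R) : 'rV[R]_4 := xget y0 [set v | exists l u y,
  [/\ l < 0 < u, l < t < u, integral_curve l u y, y 0 = y0 & v = y t]].

Lemma max_curveE l u y t : l < 0 < u -> integral_curve l u y -> y 0 = y0 ->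
  l < t < u -> max_curve t = y t.
Proof.
move=> h0 hy e ht; rewrite /max_curve; case: xgetP => [v _|/(_ (y t))]; last first.
  by case; exists l, u, y.
move=> [l' [u' [z [h0' ht' hz e' ->]]]].
have hm s : l < s < u -> l' < s < u' -> Num.max l l' < s < Num.min u u'.
  by move=> /andP[? ?] /andP[? ?]; rewrite gt_max lt_min; apply/andP; split; apply/andP.
apply: (@integral_curve_unique _ a b c (Num.max l l') (Num.min u u') 0).
- exact: hm.
- by apply: integral_curve_sub hz; rewrite ?le_max ?ge_min lexx ?orbT.
- by apply: integral_curve_sub hy; rewrite ?le_max ?ge_min lexx.
- by rewrite e e'.
- exact: hm.
Qed.

Lemma max_dom_near t : max_dom t -> \forall s \near t, max_dom s.
Proof.
move=> [l [u [y [h0 ht hy e]]]]; apply: filterS (near_itv ht) => s hs.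
by exists l, u, y.
Qed.

Lemma open_max_dom : open max_dom.
Proof. by rewrite openE => t /max_dom_near. Qed.

Lemma is_interval_max_dom : is_interval max_dom.
Proof.
move=> s t [l [u [y [h0 hs hy e]]]] [l' [u' [z [h0' ht hz e']]]] x /andP[sx xt].
have [x0|x0] := leP 0 x; first by exists l', u', z; split=> //; lra.
by exists l, u, y; split=> //; lra.
Qed.

Lemma max_curveP t : max_dom t ->
  is_derive t 1 max_curve (F (max_curve t)) /\ regular_state a b (max_curve t).
Proof.
move=> [l [u [y [h0 ht hy e]]]]; apply: (integral_curve_near ht hy).
by apply: filterS (near_itv ht) => s hs; rewrite (max_curveE h0 hy e).
Qed.

(** Shifting the time of z and gluing it to the solution that reaches t1 gives
    a solution through y0 that covers z. *)
Lemma max_curve_extend l u z s1 t1 : integral_curve l u z -> l < s1 < u ->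
  max_dom t1 -> z s1 = max_curve t1 ->
  forall s, l < s < u -> max_dom (t1 + (s - s1)) /\ max_curve (t1 + (s - s1)) = z s.
Proof.
move=> hz hs1 [l' [u' [y [h0 ht1 hy e]]]] e1 s hs.
have := integral_curve_shift (d := s1 - t1) hz; set w := fun t => _ => hw.
have h1 : l - (s1 - t1) < t1 < u - (s1 - t1) by lra.
have [|v [hv vy vw]] := integral_curve_glue ht1 h1 hy hw.
  by rewrite -(max_curveE h0 hy e ht1) -e1 /w; congr z; ring.
have h0' : Num.min l' (l - (s1 - t1)) < 0 < Num.max u' (u - (s1 - t1)).
  by case/andP: h0 => h2 h3; rewrite gt_min lt_max h2 h3.
have v0 : v 0 = y0 by rewrite vy.
have hs' : l - (s1 - t1) < t1 + (s - s1) < u - (s1 - t1) by lra.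
have hs2 : Num.min l' (l - (s1 - t1)) < t1 + (s - s1) < Num.max u' (u - (s1 - t1)).
  by case/andP: hs' => h2 h3; rewrite gt_min lt_max h2 h3 !orbT.
split; first by exists (Num.min l' (l - (s1 - t1))), (Num.max u' (u - (s1 - t1))), v.
by rewrite (max_curveE h0' hv v0 hs2) vw// /w; congr z; ring.
Qed.

(** Polynomials in the coordinates of the maximal curve: a class of functions
    closed under differentiation, as the field is polynomial. *)
Inductive curve_poly : (R -> R) -> Prop :=
| curve_poly_cst k : curve_poly (fun=> k)
| curve_poly_coord i : curve_poly (fun t => max_curve t 0 i)
| curve_poly_add f g : curve_poly f -> curve_poly g -> curve_poly (fun t => f t + g t)
| curve_poly_mul f g : curve_poly f -> curve_poly g -> curve_poly (fun t => f t * g t).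

Lemma curve_poly_field i : curve_poly (fun t => F (max_curve t) 0 i).
Proof.
have L p r x z : curve_poly (fun t => x * max_curve t 0 p + z * max_curve t 0 r).
  by apply: curve_poly_add; apply: curve_poly_mul; constructor.
case: i => -[|[|[|[|//]]]] hi; under eq_fun do rewrite mxE /=.
- by apply: curve_poly_mul; [constructor|exact: L].
- by apply: curve_poly_mul; [constructor|exact: L].
- under eq_fun do rewrite mulNr -mulN1r.
  apply: curve_poly_mul; first by constructor.
  by apply: curve_poly_mul; [constructor|exact: L].
- by apply: curve_poly_mul; [constructor|exact: L].
Qed.

Lemma curve_poly_derive f : curve_poly f -> exists2 g, curve_poly g &
  forall t, max_dom t -> is_derive t 1 f (g t).
Proof.
elim=> [k|i|{}f g hf [f' pf' df] hg [g' pg' dg]|{}f g hf [f' pf' df] hg [g' pg' dg]].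
- exists (fun=> 0); first exact: curve_poly_cst.
  by move=> t _; exact: is_derive_cst.
- exists (fun t => F (max_curve t) 0 i); first exact: curve_poly_field.
  by move=> t /max_curveP[/is_derive_rowP/(_ i)].
- exists (fun t => f' t + g' t); first exact: curve_poly_add.
  by move=> t It; apply: is_derive_add; [exact: df|exact: dg].
- exists (fun t => f' t * g t + f t * g' t).
    by apply: curve_poly_add; exact: curve_poly_mul.
  by move=> t It; apply: is_derive_mul; [exact: df|exact: dg].
Qed.

Definition row2 (x y : R) : 'rV[R]_2 := \row_i nth 0 [:: x; y] i.

Lemma row2E x y : (row2 x y 0 0 = x) * (row2 x y 0 1 = y).
Proof. by rewrite !mxE. Qed.

Lemma row2_eta (u : 'rV[R]_2) : u = row2 (u 0 0) (u 0 1).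
Proof.
apply/rowP => -[[|[|//]] hi].
- by rewrite (_ : Ordinal hi = 0) ?row2E//; exact/val_inj.
- by rewrite (_ : Ordinal hi = 1) ?row2E//; exact/val_inj.
Qed.

Lemma is_derive_row2 (V : normedModType R) (f g : V -> R) (t v : V) df dg :
  is_derive t v f df -> is_derive t v g dg ->
  is_derive t v (fun s => row2 (f s) (g s)) (row2 df dg).
Proof.
move=> hf hg; apply/is_derive_rowP => -[[|[|//]] hi]; under eq_fun do rewrite mxE /=.
- by rewrite mxE.
- by rewrite mxE.
Qed.

Definition profile (t : R) : 'rV[R]_2 := row2 (max_curve t 0 0) (max_curve t 0 1).

Lemma curve_poly_differentiable f g (h : R^o -> 'rV[R]_2) :
  curve_poly f -> curve_poly g ->
  (forall t, max_dom t -> h t = row2 (f t) (g t)) ->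
  exists f' g', [/\ curve_poly f', curve_poly g' & forall t, max_dom t ->
    is_derive (t : R) 1 (h : R -> 'rV[R]_2) (row2 (f' t) (g' t))].
Proof.
move=> pf pg e; have [f' pf' df] := curve_poly_derive pf.
have [g' pg' dg] := curve_poly_derive pg.
exists f', g'; split=> // t It.
apply: near_eq_is_derive (is_derive_row2 (df t It) (dg t It)).
by apply: filterS (max_dom_near It) => s /e.
Qed.

Lemma profile_smooth :
  smooth_on (max_dom : set R^o) (profile : R^o -> 'rV[R]_2).
Proof.
move=> vs t It.
have [f [g [pf pg e]]] : exists f g, [/\ curve_poly f, curve_poly g &
    forall t, max_dom t -> foldr (fun v h => 'D_v h) (profile : R^o -> 'rV[R]_2) vs t
      = row2 (f t) (g t)].
  elim: vs => [|v vs [f [g [pf pg IH]]]].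
    by exists (fun t => max_curve t 0 0), (fun t => max_curve t 0 1); split=> //; constructor.
  have [f' [g' [pf' pg' d]]] := curve_poly_differentiable pf pg IH.
  exists (fun t => v * f' t), (fun t => v * g' t); split.
  - by apply: curve_poly_mul => //; constructor.
  - by apply: curve_poly_mul => //; constructor.
  move=> {It}t It /=; have [/derivable1_diffP diff e] := d t It.
  rewrite deriveE//; have := @deriveE _ _ _ _ t (1 : R^o) diff; rewrite e => e1.
  have {1}-> : v = v *: (1 : R^o) by rewrite /GRing.scale /= mulr1.
  rewrite linearZ -e1; apply/rowP => i; rewrite !mxE.
  by case: i => -[|[|//]] hi /=.
have [f' [g' [_ _ d]]] := curve_poly_differentiable pf pg e.
by have [/derivable1_diffP] := d t It.
Qed.

Lemma profile_derive1 t : max_dom t -> derive1 profile t != 0.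
Proof.
move=> It; have [/is_derive_rowP d [pq P0]] := max_curveP It.
rewrite derive1E (@derive_val _ _ _ _ _ _ _ (is_derive_row2 (d 0) (d 1))).
rewrite !row4E; apply/eqP => /rowP e; have := e 0; have := e 1; rewrite !mxE /=.
move=> /eqP; rewrite mulf_eq0 (negbTE P0) orbF => /eqP p0.
move=> /eqP; rewrite mulf_eq0 (negbTE P0) orbF => /eqP q0.
by move: pq; rewrite p0 q0 expr0n addr0 => /esym/eqP; rewrite oner_eq0.
Qed.

End MaximalCurve.

(** * Change of parameter *)
Section Reparametrization.
Variable R : realType.

Lemma antiderivative (g : R -> R) (a b : R) :
  (forall t, a <= t <= b -> {for t, continuous g}) ->
  exists tau : R -> R, forall t, a < t < b -> is_derive t 1 tau (g t).
Proof.
move=> cg; exists (fun x => \int[lebesgue_measure]_(t in `[a, x]) g t) => t /andP[at_ tb].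
have ig : lebesgue_measure.-integrable `[a, b] (EFin \o g).
  apply: continuous_compact_integrable; first exact: segment_compact.
  by apply: continuous_in_subspaceT => x; rewrite inE/= in_itv/=; exact: cg.
have [|d1 d2] := continuous_FTC1_closed tb ig at_; first by apply: cg; rewrite !ltW.
by apply: DeriveDef => //; rewrite -derive1E.
Qed.

Lemma locally_nonzero_sign (g : R -> R) (t0 : R) : g t0 != 0 ->
  {for t0, continuous g} -> \forall t \near t0, 0 < g t * g t0.
Proof.
move=> g0 cg; have : g t * g t0 @[t --> t0] --> g t0 * g t0.
  by apply: cvgM => //; exact: cvg_cst.
move=> /cvgr_gt; apply; rewrite -expr2 lt0r sqrf_eq0 g0 sqr_ge0//.
Qed.

Variables (a b c : R).
Local Notation F := (profile_field a b c).

(** The new parameter is an antiderivative of the speed g.  Near t0 the speed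
    has constant sign, so the new parameter is strictly monotone, and its
    inverse has derivative 1 / g. *)
Lemma reparametrize (a1 b1 t0 : R) (y : R -> 'rV[R]_4) (g : R -> R) :
  a1 < t0 < b1 ->
  (forall t, a1 < t < b1 -> [/\ is_derive t 1 y (g t *: F (y t)), g t != 0,
     {for t, continuous g} & regular_state a b (y t)]) ->
  exists (l u : R) (z : R -> 'rV[R]_4) (tau : R -> R), integral_curve a b c l u z /\
    \forall t \near t0, [/\ l < tau t < u, {for t, continuous tau} & z (tau t) = y t].
Proof.
move=> ht0 H; have [d0 g0 cg0 _] := H t0 ht0.
have [e /= e0 he] : exists2 e : R, 0 < e & forall t, t0 - e <= t <= t0 + e ->
    a1 < t < b1 /\ 0 < g t * g t0.
  have : \forall t \near t0, a1 < t < b1 /\ 0 < g t * g t0.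
    by apply: filterS2 (near_itv ht0) (locally_nonzero_sign g0 cg0).
  move=> /nbhs_ballP[e /= e0 he]; exists (e / 2); first by rewrite divr_gt0.
  by move=> t ht; apply: he; rewrite /ball/= ltr_distlC; lra.
have [tau dtau] : exists tau : R -> R, forall t, t0 - e < t < t0 + e ->
    is_derive t 1 tau (g t).
  by apply: antiderivative => t /he[/H[]].
(* The antiderivative is known on the open interval only; halving the radius
   gives a closed one. *)
pose e2 := e / 2; have e20 : 0 < e2 by rewrite divr_gt0.
have dt t : t0 - e2 <= t <= t0 + e2 -> is_derive t 1 tau (g t).
  by move=> ht; apply: dtau; rewrite /e2 in ht; lra.
have mvt s t : t0 - e2 <= s -> s < t -> t <= t0 + e2 ->
    exists2 x, t0 - e2 <= x <= t0 + e2 & tau t - tau s = g x * (t - s).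
  move=> hs st htt; have [| |x] := @MVT _ tau g s t st.
  - by move=> x; rewrite in_itv/= => hx; apply: dt; lra.
  - apply: derivable_within_continuous => x; rewrite in_itv/= => hx.
    by have [] : is_derive x 1 tau (g x) by apply: dt; lra.
  - by rewrite in_itv/= => hx ->; exists x => //; lra.
have sgn x : t0 - e2 <= x <= t0 + e2 -> 0 < g x * g t0.
  by move=> hx; have [|_] := he x; rewrite /e2 in hx; lra.
have inj s t : t0 - e2 <= s <= t0 + e2 -> t0 - e2 <= t <= t0 + e2 ->
    tau s = tau t -> s = t.
  move=> hs ht E; case: (ltgtP s t) => // st.
  - have [||x hx] := mvt s t _ st; [lra|lra|].
    rewrite E subrr => /esym/eqP; rewrite mulf_eq0 subr_eq0 (gt_eqF st) orbF => /eqP gx.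
    by have := sgn x hx; rewrite gx mul0r ltxx.
  - have [||x hx] := mvt t s _ st; [lra|lra|].
    rewrite E subrr => /esym/eqP; rewrite mulf_eq0 subr_eq0 (gt_eqF st) orbF => /eqP gx.
    by have := sgn x hx; rewrite gx mul0r ltxx.
pose l := Num.min (tau (t0 - e2)) (tau (t0 + e2)).
pose u := Num.max (tau (t0 - e2)) (tau (t0 + e2)).
have tau0 : l < tau t0 < u.
  have [|||x1 hx1 E1] := mvt (t0 - e2) t0 _ _ _; [lra|lra|lra|].
  have [|||x2 hx2 E2] := mvt t0 (t0 + e2) _ _ _; [lra|lra|lra|].
  have := sgn _ hx1; have := sgn _ hx2; rewrite gt_min lt_max.
  have h1 : t0 - (t0 - e2) = e2 by ring.
  have h2 : t0 + e2 - t0 = e2 by ring.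
  rewrite h1 in E1; rewrite h2 in E2.
  have [gp|gn|] := ltgtP (g t0) 0.
  - rewrite !nmulr_lgt0// => g2 g1; apply/andP; split; apply/orP.
      by right; have : g x2 * e2 < 0; [rewrite pmulr_llt0|lra].
    by left; have : g x1 * e2 < 0; [rewrite pmulr_llt0|lra].
  - rewrite !pmulr_lgt0// => g2 g1; apply/andP; split; apply/orP.
      by left; have : 0 < g x1 * e2; [rewrite mulr_gt0|lra].
    by right; have : 0 < g x2 * e2; [rewrite mulr_gt0|lra].
  - by move=> g00; rewrite g00 eqxx in g0.
have cw : {within `[t0 - e2, t0 + e2], continuous tau}.
  apply: derivable_within_continuous => x; rewrite in_itv/= => hx.
  by have [] := dt x hx.
have surj v : l < v < u -> exists2 t, t0 - e2 < t < t0 + e2 & tau t = v.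
  move=> hv; have [||t] := @IVT R tau (t0 - e2) (t0 + e2) v _ cw.
  - by lra.
  - by case/andP: hv => /ltW h1 /ltW h2; apply/andP.
  rewrite in_itv/= => /andP[h1 h2] E; exists t => //.
  rewrite !lt_neqAle h1 h2 !andbT; apply/andP; split.
    apply: contraTneq hv => ?; subst t; rewrite -E /l /u gt_min lt_max !ltxx/=.
    by apply/negP => /andP[h3 h4]; have := lt_trans h3 h4; rewrite ltxx.
  apply: contraTneq hv => ?; subst t; rewrite -E /l /u gt_min lt_max !ltxx/= !orbF.
  by apply/negP => /andP[h3 h4]; have := lt_trans h3 h4; rewrite ltxx.
pose sg v := xget t0 [set t | t0 - e2 <= t <= t0 + e2 /\ tau t = v].
have sgK t : t0 - e2 <= t <= t0 + e2 -> sg (tau t) = t.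
  move=> ht; rewrite /sg; case: xgetP => [x _ [hx E]|/(_ t)]; last by case.
  exact: inj.
exists l, u, (fun v => y (sg v)), tau; split.
  move=> v /surj[t ht <-].
  have ht' : t0 - e2 <= t <= t0 + e2 by case/andP: ht => *; rewrite !ltW.
  have [|hab _] := he t; first by rewrite /e2 in ht; lra.
  have [dy gt cgt reg] := H t hab.
  rewrite (sgK _ ht'); split=> //.
  have dsg : is_derive (tau t) 1 sg (g t)^-1.
    apply: (is_derive_inverse _ _ (dt t ht') gt).
      by apply: filterS (near_itv ht) => s /andP[? ?]; rewrite sgK// !ltW.
    apply: filterS (near_itv ht) => s /andP[? ?].
    have /dt/is_derive_continuous : t0 - e2 <= s <= t0 + e2 by rewrite !ltW.
    by [].
  apply/is_derive_rowP => i; move/is_derive_rowP/(_ i) : dy => dy.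
  have dy' : is_derive (sg (tau t)) 1 (fun s => y s 0 i) ((g t *: F (y t)) 0 i).
    by rewrite sgK.
  apply: (is_derive_val (is_derive_comp dy' dsg)).
  by rewrite mxE mulrAC mulfV// mul1r.
have ht0' : t0 - e2 < t0 < t0 + e2 by lra.
have nl : \forall t \near t0, l < tau t < u.
  have /is_derive_continuous ct := dt t0 ltac:(lra).
  exact: (ct _ (near_itv tau0)).
near=> t; have ht : t0 - e2 < t < t0 + e2 by near: t; exact: near_itv.
have ht' : t0 - e2 <= t <= t0 + e2 by case/andP: ht => *; rewrite !ltW.
split; first by near: t.
  exact: is_derive_continuous (dt t ht').
by rewrite sgK.
Unshelve. all: by end_near. Qed.

End Reparametrization.

(** * Symmetry of second derivatives *)
Section Schwarz.
Variables (R : realType) (V : normedModType R).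

Lemma differentiable_estimate (g : V -> R) (p : V) (e : R) : differentiable g p ->
  0 < e -> \forall k \near (0 : V), `|g (k + p) - g p - 'd g p k| <= e * `|k|.
Proof.
move=> dg e0; have /eqaddoP H := diff_locally dg.
by have := H e e0; apply: filterS => k; rewrite /= opprD addrA.
Qed.

Lemma is_derive_line (W : normedModType R) (f : V -> W) (p v : V) (s : R) d :
  is_derive (p + s *: v) v f d -> is_derive s 1 (fun s => f (p + s *: v)) d.
Proof.
move=> [df <-].
have e : (fun h : R => h^-1 *: (((fun s => f (p + s *: v)) \o shift s) (h *: 1)
      - f (p + s *: v))) =
    (fun h : R => h^-1 *: ((f \o shift (p + s *: v)) (h *: v) - f (p + s *: v))).
  apply/funext => h; congr (_ *: (f _ - _)).
  by rewrite /= [h *: 1]mulr1 scalerDl addrCA addrA.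
by apply: DeriveDef; rewrite /derivable /derive ?e.
Qed.

Definition second_difference (f : V -> R) (p v w : V) (h : R) :=
  f (p + h *: v + h *: w) - f (p + h *: v) - f (p + h *: w) + f p.

(** The mean value theorem in the direction v writes the second difference as h
    times a difference of values of the derivative g of f along v, at two points
    whose distance to p is of order h; there g differs from its linear part by
    o(h). *)
Lemma second_difference_estimate (U : set V) (f : V -> R) (p v w : V) (e : R) :
  open U -> U p -> (forall q, U q -> differentiable f q) ->
  differentiable ('D_v f) p -> 0 < e ->
  \forall h \near 0^'+, `|second_difference f p v w h / h ^+ 2 - 'D_w ('D_v f) p| <= e.
Proof.
move=> oU Up df dg e0; set g := 'D_v f.
(* The two points where g is evaluated lie within h (|v| + |w|) and h |v| of p;
   the extra 1 keeps C positive. *)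
pose C := 2 * `|v| + `|w| + 1.
have C0 : 0 < C by rewrite /C; have := normr_ge0 v; have := normr_ge0 w; lra.
have := differentiable_estimate dg (divr_gt0 e0 C0) => est.
have nU : \forall k \near (0 : V), U (k + p).
  have cs : k + p @[k --> (0 : V)] --> p.
    by rewrite -[X in _ --> X]add0r; apply: cvgD; [exact: cvg_id|exact: cvg_cst].
  by apply: cs; move: oU; rewrite openE; exact.
have /nbhs_ballP[r /= r0 hr] : \forall k \near (0 : V),
    `|g (k + p) - g p - 'd g p k| <= e / C * `|k| /\ U (k + p).
  by apply: filterS2 est nU.
near=> h; have h0 : 0 < h by [].
have hC : h * C < r.
  rewrite -ltr_pdivlMr//; near: h; apply: nbhs_right_lt; exact: divr_gt0.
have inb s t : 0 <= s <= h -> 0 <= t <= h -> ball (0 : V) r (s *: v + t *: w).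
  move=> /andP[s0 sh] /andP[t0 th]; rewrite -ball_normE /= sub0r normrN.
  apply: le_lt_trans hC; apply: le_trans (ler_normD _ _) _.
  rewrite !normrZ !ger0_norm// /C.
  have := normr_ge0 v; have := normr_ge0 w; nra.
have hU s t : 0 <= s <= h -> 0 <= t <= h -> U (p + s *: v + t *: w).
  move=> hs ht; have [_ h1] := hr _ (inb s t hs ht).
  by rewrite (_ : p + _ + _ = s *: v + t *: w + p); [exact: h1|rewrite -addrA addrC].
have hE s t : 0 <= s <= h -> 0 <= t <= h ->
    `|g (p + s *: v + t *: w) - g p - 'd g p (s *: v + t *: w)|
      <= e / C * `|s *: v + t *: w|.
  move=> hs ht; have [h1 _] := hr _ (inb s t hs ht).
  by rewrite (_ : p + _ + _ = s *: v + t *: w + p); [exact: h1|rewrite -addrA addrC].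
have hh : 0 <= h <= h by rewrite lexx andbT ltW.
have h00 : 0 <= (0 : R) <= h by rewrite lexx ltW.
pose F s := f (p + h *: w + s *: v) - f (p + s *: v).
have dF s : 0 <= s <= h -> is_derive s 1 F
    (g (p + h *: w + s *: v) - g (p + s *: v)).
  move=> hs; apply: is_derive_sub; apply: is_derive_line; apply/derivableP/diff_derivable.
    by apply: df; rewrite addrAC; exact: hU.
  by apply: df; have := hU s 0 hs h00; rewrite scale0r addr0.
have [| |x] := @MVT _ F (fun s => g (p + h *: w + s *: v) - g (p + s *: v)) 0 h h0.
- by move=> x; rewrite in_itv/= => /andP[? ?]; apply: dF; rewrite !ltW.
- apply: derivable_within_continuous => x; rewrite in_itv/= => /dF.
  by case.
rewrite in_itv/= => /andP[x0 xh].
have hx : 0 <= x <= h by rewrite !ltW.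
have -> : F h - F 0 = second_difference f p v w h.
  by rewrite /F /second_difference !scale0r !addr0 (addrAC p); ring.
rewrite subr0 => ->.
have E1 := hE x h hx hh; have := hE x 0 hx h00; rewrite scale0r !addr0 => E2.
rewrite deriveE// -/g.
have -> : 'd g p w = ('d g p (x *: v + h *: w) - 'd g p (x *: v)) / h.
  by rewrite linearD [X in _ + X - _]linearZ /= addrC addKr /GRing.scale /= mulrAC mulfV ?mul1r// gt_eqF.
rewrite (addrAC p); set G1 := g _ in E1 *; set G2 := g _ in E2 *.
set D1 := 'd g p _ in E1 *; set D2 := 'd g p _ in E2 *.
have -> : (G1 - G2) * h / h ^+ 2 - (D1 - D2) / h
    = ((G1 - g p - D1) - (G2 - g p - D2)) / h by field; rewrite gt_eqF.
rewrite normrM normfV (gtr0_norm h0) ler_pdivrMr//.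
apply: le_trans (ler_normB _ _) _.
have n1 : `|x *: v + h *: w| <= h * (`|v| + `|w|).
  apply: le_trans (ler_normD _ _) _; rewrite !normrZ (gtr0_norm h0) gtr0_norm//.
  by have := normr_ge0 v; nra.
have n2 : `|x *: v| <= h * `|v|.
  by rewrite normrZ gtr0_norm//; have := normr_ge0 v; nra.
have eC := divr_gt0 e0 C0.
apply: (@le_trans _ _ (e / C * (h * (`|v| + `|w|)) + e / C * (h * `|v|))).
  by apply: lerD; [apply: le_trans E1 _|apply: le_trans E2 _]; rewrite ler_pM2l.
rewrite -mulrDr -mulrDr (_ : `|v| + `|w| + `|v| = C - 1); last by rewrite /C; ring.
apply: (@le_trans _ _ (e / C * (h * C))).
  by rewrite ler_pM2l// ler_pM2l//; lra.
by rewrite mulrCA divfK ?gt_eqF// mulrC.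
Unshelve. all: by end_near. Qed.

Lemma second_differenceC f p v w h :
  second_difference f p v w h = second_difference f p w v h.
Proof. by rewrite /second_difference (addrAC p); ring. Qed.

(** Both mixed derivatives are limits of the same second difference quotient. *)
Lemma derive_symmetric (U : set V) (f : V -> R) (p v w : V) :
  open U -> U p -> (forall q, U q -> differentiable f q) ->
  differentiable ('D_v f) p -> differentiable ('D_w f) p ->
  'D_w ('D_v f) p = 'D_v ('D_w f) p.
Proof.
move=> oU Up df dv dw; apply/eqP; rewrite -subr_eq0 -normr_le0.
apply/ler_addgt0Pr => e e0; rewrite add0r; have e2 : 0 < e / 2 by rewrite divr_gt0.
have E1 := second_difference_estimate w oU Up df dv e2.
have E2 : \forall h \near 0^'+,
    `|second_difference f p v w h / h ^+ 2 - 'D_v ('D_w f) p| <= e / 2.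
  apply: filterS (second_difference_estimate v oU Up df dw e2) => h.
  by rewrite (second_differenceC f p w v h).
have K (Q x y : R) : `|Q - x| <= e / 2 -> `|Q - y| <= e / 2 -> `|x - y| <= e.
  by rewrite !ler_norml => h1 h2; lra.
suff : \forall h \near (0 : R)^'+, `|'D_w ('D_v f) p - 'D_v ('D_w f) p| <= e.
  by move=> H; near (0 : R)^'+ => h; near: h.
by apply: filterS2 E1 E2 => h; exact: K.
Unshelve. all: by end_near. Qed.

End Schwarz.

(** * First-order data of a surface and change of coordinates *)
Section NearDifferential.
Variables (R : realType) (V W : normedModType R).

Lemma near_eq_diff (f g : V -> W) (p : V) : (\forall q \near p, f q = g q) ->
  differentiable f p -> differentiable g p /\ forall v, 'd g p v = 'd f p v.
Proof.
move=> fg df; have [cd /eqaddoP H] := (diff_locallyP p f).1 df.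
have E : g \o shift p = cst (g p) + 'd f p +o_ 0 id.
  apply/eqaddoP => e e0; have cs : k + p @[k --> (0 : V)] --> p.
    by rewrite -[X in _ --> X]add0r; apply: cvgD; [exact: cvg_id|exact: cvg_cst].
  have fg0 : \forall k \near (0 : V), f (k + p) = g (k + p) by exact: (cs _ fg).
  have := H e e0; apply: filterS2 fg0 => k ek.
  suff -> : (f \o shift p - (cst (f p) + 'd f p)) k =
    (g \o shift p - (cst (g p) + 'd f p)) k by [].
  change (f (k + p) - (f p + 'd f p k) = g (k + p) - (g p + 'd f p k)).
  by rewrite ek (nbhs_singleton fg).
have D : ('d g p : V -> W) = 'd f p by exact: (diff_unique cd E).
by split; [apply/diff_locallyP; rewrite D; split; [exact: cd|exact: E]|move=> v; exact: (congr1 (fun h => h v) D)].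
Qed.

End NearDifferential.

Lemma diff_comp_at (R : realType) (U V W : normedModType R) (f : U -> V)
    (g : V -> W) (p v : U) : differentiable f p -> differentiable g (f p) ->
  'd (g \o f) p v = 'd g (f p) ('d f p v).
Proof. by move=> df dg; exact: (congr1 (fun h => h v) (diff_comp df dg)). Qed.

Lemma det22 (R : comPzRingType) (A : 'M[R]_2) : \det A = A 0 0 * A 1 1 - A 0 1 * A 1 0.
Proof.
rewrite (expand_det_row A 0) !big_ord_recl big_ord0 addr0 /cofactor !det_mx11 !mxE /=.
rewrite expr0 expr1 mul1r mulN1r mulrN.
by congr (_ * A _ _ - A _ _ * A _ _); apply/val_inj.
Qed.

Section Germ.
Variable R : realType.
Local Notation e0 := (delta_mx 0 0 : 'rV[R]_2).
Local Notation e1 := (delta_mx 0 1 : 'rV[R]_2).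

(** What survives a change of coordinates that is merely differentiable at u;
    [germ_symmetric] is the symmetry of the second fundamental form, stated
    without second derivatives for this reason. *)
Record surface_germ (X N : 'rV[R]_2 -> 'rV[R]_3) (u : 'rV[R]_2) : Prop :=
  SurfaceGerm {
  germ_X : differentiable X u;
  germ_N : differentiable N u;
  germ_immersion : injective ('d X u);
  germ_unit : dot (N u) (N u) = 1;
  germ_normal : forall v, dot (N u) ('d X u v) = 0;
  germ_dN : forall v, dot (N u) ('d N u v) = 0;
  germ_symmetric : forall v w,
    dot ('d X u v) ('d N u w) = dot ('d X u w) ('d N u v) }.

Lemma germ_pullback (f m : 'rV[R]_2 -> 'rV[R]_3) (tau : 'rV[R]_2 -> 'rV[R]_2)
    (X N : 'rV[R]_2 -> 'rV[R]_3) (u : 'rV[R]_2) :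
  surface_germ f m (tau u) -> differentiable tau u -> injective ('d tau u) ->
  (\forall q \near u, X q = f (tau q)) -> (\forall q \near u, N q = m (tau q)) ->
  surface_germ X N u /\ (forall v, 'd X u v = 'd f (tau u) ('d tau u v)) /\
  (forall v, 'd N u v = 'd m (tau u) ('d tau u v)).
Proof.
move=> [df dm inj1 mm mf mdm sym] dt injt eX eN.
have [dX EX] := near_eq_diff (f := f \o tau) (g := X)
  (filterS (fun q h => esym h) eX) (differentiable_comp dt df).
have [dN EN] := near_eq_diff (f := m \o tau) (g := N)
  (filterS (fun q h => esym h) eN) (differentiable_comp dt dm).
have DX v : 'd X u v = 'd f (tau u) ('d tau u v).
  exact: (etrans (EX v) (diff_comp_at v dt df)).
have DN v : 'd N u v = 'd m (tau u) ('d tau u v).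
  exact: (etrans (EN v) (diff_comp_at v dt dm)).
have Nu := nbhs_singleton eN.
split; last by split; [exact: DX|exact: DN].
apply: SurfaceGerm; [exact: dX|exact: dN| | | | |].
- move=> v w h; apply: injt; apply: inj1.
  exact: (etrans (esym (DX v)) (etrans h (DX w))).
- by rewrite Nu.
- by move=> v; exact: (etrans (congr2 (@dot R) Nu (DX v)) (mf _)).
- by move=> v; exact: (etrans (congr2 (@dot R) Nu (DN v)) (mdm _)).
- move=> v w; exact: (etrans (congr2 (@dot R) (DX v) (DN w)) (etrans (sym _ _)
    (esym (congr2 (@dot R) (DX w) (DN v))))).
Qed.

Lemma delta_mx_basis (v : 'rV[R]_2) : v = v 0 0 *: e0 + v 0 1 *: e1.
Proof.
apply/rowP => -[[|[|//]] hi]; rewrite !mxE /=.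
- by rewrite mulr1 mulr0 addr0; congr (v _ _); exact/val_inj.
- by rewrite mulr1 mulr0 add0r; congr (v _ _); exact/val_inj.
Qed.

Lemma germ_independent X N u : surface_germ X N u ->
  cross ('d X u e0) ('d X u e1) != 0.
Proof.
move=> G; apply/eqP => c0.
have X00 : 'd X u e0 != 0.
  apply/eqP => h; have := @germ_immersion _ _ _ G e0 0; rewrite h linear0 => /(_ erefl).
  by move/rowP/(_ 0); rewrite !mxE /= => /eqP; rewrite oner_eq0.
have E := cross_eq0 X00 c0; set m := _ / _ in E.
have : e1 = m *: e0 by apply: (germ_immersion G); rewrite linearZ.
by move/rowP/(_ 1); rewrite !mxE /= mulr0 => /eqP; rewrite oner_eq0.
Qed.

Local Notation J f u := ('J f u).

Lemma gram_entry (X Y : 'rV[R]_2 -> 'rV[R]_3) u i j :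
  (J X u *m (J Y u)^T) i j = dot ('d X u (delta_mx 0 i)) ('d Y u (delta_mx 0 j)).
Proof.
have E (Z : 'rV[R]_2 -> 'rV[R]_3) k l : J Z u k l = 'd Z u (delta_mx 0 k) 0 l.
  have <- : delta_mx 0 k *m J Z u = 'd Z u (delta_mx 0 k) by exact: mul_rV_lin1.
  by rewrite -rowE /row [RHS]mxE.
rewrite mxE /dot mxE; apply: eq_bigr => k _; rewrite [(J Y u)^T k j]mxE.
rewrite [X in _ = _ * X]mxE; exact: (congr2 *%R (E X i k) (E Y j k)).
Qed.

Lemma jacobian_pullback (X f : 'rV[R]_2 -> 'rV[R]_3) (tau : 'rV[R]_2 -> 'rV[R]_2) u :
  (forall v, 'd X u v = 'd f (tau u) ('d tau u v)) -> J X u = J tau u *m J f (tau u).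
Proof.
move=> H; apply/row_matrixP => i.
rewrite row_mul rowE (rowE i (J tau u)).
have E (p q : nat) (Z : 'rV[R]_p -> 'rV[R]_q) w v : v *m 'J Z w = 'd Z w v.
  exact: mul_rV_lin1.
have E3 : delta_mx 0 i *m J tau u *m J f (tau u) = 'd tau u (delta_mx 0 i) *m J f (tau u).
  exact: (congr1 (mulmx^~ (J f (tau u))) (E _ _ tau u _)).
exact: (etrans (E _ _ X u _) (etrans (H _) (esym (etrans E3 (E _ _ f _ _))))).
Qed.

Definition gram (X Y : 'rV[R]_2 -> 'rV[R]_3) u : 'M[R]_2 := J X u *m (J Y u)^T.

Lemma gram_unit X N u : surface_germ X N u -> gram X X u \in unitmx.
Proof.
move=> /germ_independent c0; rewrite unitmxE unitfE det22 !gram_entry.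
have := cross_norm2 ('d X u e0) ('d X u e1); rewrite expr2.
rewrite {2}(dotC ('d X u e0)) => <-.
by rewrite gt_eqF// dot_gt0.
Qed.

Definition shape (X N : 'rV[R]_2 -> 'rV[R]_3) u : 'M[R]_2 :=
  - gram X N u *m invmx (gram X X u).

(** A change of coordinates with Jacobian T conjugates the shape operator by T.
    Trace and determinant suffice, as the Weingarten relation is symmetric in
    the principal curvatures. *)
Lemma shape_similar (T : 'M[R]_2) (A B : 'M[R]_(2, 3)) :
  A *m A^T \in unitmx -> T \in unitmx ->
  let S := - (A *m B^T) *m invmx (A *m A^T) in
  let S' := - (T *m A *m (T *m B)^T) *m invmx (T *m A *m (T *m A)^T) in
  \tr S' = \tr S /\ \det S' = \det S.
Proof.
move=> gu tu S S'; have -> : S' = T *m S *m invmx T.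
  have tut : T^T \in unitmx by rewrite unitmx_tr.
  rewrite /S' /S; move: gu; set G := A *m A^T => gu.
  have -> : T *m A *m (T *m A)^T = T *m G *m T^T by rewrite trmx_mul /G !mulmxA.
  have inv3 (H : 'M[R]_2) : H \in unitmx ->
      invmx (T *m H *m T^T) = invmx T^T *m invmx H *m invmx T.
    move=> Hu; have U : T *m H *m T^T \in unitmx by rewrite !unitmx_mul tu Hu.
    apply: (can_inj (mulKmx U)); rewrite mulmxV//.
    by rewrite !mulmxA mulmxK// mulmxK// mulmxV.
  rewrite (inv3 _ gu) trmx_mul !(mulNmx, mulmxN); congr (- _).
  move: (invmx G) => K; by rewrite !mulmxA mulmxK.
move: S {S'} => S; split; first by rewrite mxtrace_mulC mulmxA mulVmx// mul1mx.
by rewrite !det_mulmx mulrAC -det_mulmx mulmxV// det1 mul1r.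
Qed.

Lemma shape_pullback (f m : 'rV[R]_2 -> 'rV[R]_3) (tau : 'rV[R]_2 -> 'rV[R]_2)
    (X N : 'rV[R]_2 -> 'rV[R]_3) (u : 'rV[R]_2) :
  gram f f (tau u) \in unitmx -> J tau u \in unitmx ->
  J X u = J tau u *m J f (tau u) -> J N u = J tau u *m J m (tau u) ->
  \tr (shape X N u) = \tr (shape f m (tau u)) /\
  \det (shape X N u) = \det (shape f m (tau u)).
Proof.
rewrite /shape /gram => gu tu -> ->; exact: shape_similar gu tu.
Qed.

(** The eigenvector condition controls - <x_0, y_j>; the symmetry hypothesis
    turns it into a statement on y_0.  As y_1 is tangent, it is a combination of
    x_0 and x_1, and the shape operator becomes the triangular matrix M. *)
Lemma principal_frame (x y : 'I_2 -> 'rV[R]_3) (n : 'rV[R]_3) (G H : 'M[R]_2) k :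
  G \in unitmx -> n != 0 -> cross (x 0) (x 1) != 0 ->
  (forall i j, G i j = dot (x i) (x j)) -> (forall i j, H i j = dot (x i) (y j)) ->
  (forall i j, dot (x i) (y j) = dot (x j) (y i)) ->
  (forall i, dot n (x i) = 0) -> (forall i, dot n (y i) = 0) ->
  (e0 <= eigenspace (- H *m invmx G) k)%MS ->
  exists l al, [/\ y 0 = - k *: x 0, y 1 + l *: x 1 = al *: x 0,
    \tr (- H *m invmx G) = k + l & \det (- H *m invmx G) = k * l].
Proof.
move=> gu n0 c0 GE HE sym nx ny /eigenspaceP E.
have span w : dot w n = 0 -> dot w (x 0) = 0 -> dot w (x 1) = 0 -> w = 0.
  apply: (orth_frame c0 n0); exact: nx.
have E' j : - dot (x 0) (y j) = k * dot (x 0) (x j).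
  have : e0 *m (- H) = k *: e0 *m G by rewrite -E -!mulmxA mulVmx// mulmx1.
  move/rowP/(_ j); rewrite mulmxN -scalemxAl -!rowE mxE [RHS]mxE !mxE.
  by rewrite -GE -HE.
have dN0 : y 0 = - k *: x 0.
  apply/eqP; rewrite -subr_eq0; apply/eqP; apply: span.
  - by rewrite dotDl dotNl dotZl !(dotC _ n) nx ny mulr0 subr0.
  - rewrite dotDl dotNl dotZl (dotC (y 0)) -[X in X - _]opprK E'; ring.
  - rewrite dotDl dotNl dotZl (dotC (y 0)) sym -[X in X - _]opprK E'; ring.
set E00 := dot (x 0) (x 0); set E01 := dot (x 0) (x 1).
set E11 := dot (x 1) (x 1).
set n0' := dot (y 1) (x 0); set n1' := dot (y 1) (x 1).
have D0 : E00 * E11 - E01 ^+ 2 != 0.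
  by rewrite -cross_norm2 gt_eqF// dot_gt0.
pose al := (n0' * E11 - n1' * E01) / (E00 * E11 - E01 ^+ 2).
pose l := - ((n1' * E00 - n0' * E01) / (E00 * E11 - E01 ^+ 2)).
have dN1 : y 1 + l *: x 1 = al *: x 0.
  apply/eqP; rewrite -subr_eq0; apply/eqP; apply: span.
  - rewrite !dotDl dotNl !dotZl !(dotC _ n) !nx ny; ring.
  - rewrite !dotDl dotNl !dotZl -/n0' -/E00 (dotC (x 1)) -/E01 /l /al; field.
    by [].
  - rewrite !dotDl dotNl !dotZl -/n1' -/E01 -/E11 /l /al; field.
    by [].
pose M : 'M[R]_2 := \matrix_(i, j) nth 0 (nth [::] [:: [:: k; 0]; [:: - al; l]] i) j.
have ME : (M 0 0 = k) * (M 0 1 = 0) * (M 1 0 = - al) * (M 1 1 = l) by rewrite !mxE.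
have I2 (i : 'I_2) : i = 0 \/ i = 1.
  by case: i => -[|[|//]] hi; [left|right]; exact/val_inj.
have -> : - H *m invmx G = M.
  apply: (can_inj (mulmxK gu)); rewrite mulmxKV//.
  apply/matrixP => i j; rewrite mxE [RHS]mxE HE sym.
  rewrite (_ : \sum_k0 _ = M i 0 * G 0 j + M i 1 * G 1 j); last first.
    rewrite !big_ord_recl big_ord0 addr0.
    by congr (M i _ * G _ j + M i _ * G _ j); exact/val_inj.
  rewrite !GE; case: (I2 i) => ->; rewrite !ME.
    by rewrite dN0 dotZr (dotC (x j)); ring.
  have -> : y 1 = al *: x 0 - l *: x 1 by rewrite -dN1 addrK.
  by rewrite dotDr dotNr !dotZr !(dotC (x j)); ring.
exists l, al; split; [exact: dN0|exact: dN1| |].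
- rewrite /mxtrace !big_ord_recl big_ord0 addr0 -[in RHS]ME.2.
  by rewrite -[k in RHS]ME.1.1.1; congr (M _ _ + M _ _); exact/val_inj.
- by rewrite det22 !ME mul0r subr0.
Qed.

Lemma germ_principal X N u k : surface_germ X N u ->
  (e0 <= eigenspace (shape X N u) k)%MS ->
  exists l al, [/\ 'd N u e0 = - k *: 'd X u e0,
    'd N u e1 + l *: 'd X u e1 = al *: 'd X u e0,
    \tr (shape X N u) = k + l & \det (shape X N u) = k * l].
Proof.
move=> G E; have N0 : N u != 0.
  apply/eqP => h; have := germ_unit G; rewrite h dot0l => /esym/eqP.
  by rewrite oner_eq0.
apply: (@principal_frame (fun i => 'd X u (delta_mx 0 i))
  (fun i => 'd N u (delta_mx 0 i)) (N u) _ _ k (gram_unit G) N0 (germ_independent G)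
  _ _ _ _ _ E).
- by move=> i j; exact: gram_entry.
- by move=> i j; exact: gram_entry.
- by move=> i j; exact: (germ_symmetric G).
- by move=> i; exact: (germ_normal G).
- by move=> i; exact: (germ_dN G).
Qed.

End Germ.

(** * First-order data in the charts of the atlas *)
Section AtlasGerm.
Variables (R : realType).

Lemma near_open (T : topologicalType) (U : set T) (p : T) : open U -> U p ->
  \forall q \near p, U q.
Proof. by rewrite openE => oU Up; exact: (oU p Up). Qed.

Lemma differentiable_entry (V : normedModType R) n (f : V -> 'rV[R]_n.+1) (p : V) i :
  differentiable f p -> differentiable (fun q => f q 0 i : R) p.
Proof.
move=> df; apply: (differentiable_comp (g := fun v : 'rV[R]_n.+1 => v 0 i) df).
exact: differentiable_coord.
Qed.

Lemma differentiable_is_derive (V W : normedModType R) (f : V -> W) (p v : V) :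
  differentiable f p -> is_derive p v f ('D_v f p).
Proof. by move=> df; apply: derivableP; exact: diff_derivable. Qed.

Lemma derive_symmetric_row (V : normedModType R) n (U : set V) (f : V -> 'rV[R]_n.+1)
    (p v w : V) : open U -> U p -> (forall q, U q -> differentiable f q) ->
  differentiable ('D_v f) p -> differentiable ('D_w f) p ->
  'D_w ('D_v f) p = 'D_v ('D_w f) p.
Proof.
move=> oU Up df dv dw; apply/rowP => i.
have Df q (z : V) : U q -> 'D_z (fun q => f q 0 i : R) q = 'D_z f q 0 i.
  move=> Uq; have /is_derive_rowP/(_ i) h := differentiable_is_derive z (df q Uq).
  exact: (@derive_val _ _ _ _ _ _ _ h).
have nD (z : V) : \forall q \near p, 'D_z f q 0 i = 'D_z (fun q => f q 0 i : R) q.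
  by apply: filterS (near_open oU Up) => q Uq; exact: (esym (Df q z Uq)).
have dD z : differentiable ('D_z f) p -> differentiable ('D_z (fun q => f q 0 i : R)) p.
  move=> h; exact: (near_eq_diff (nD z) (differentiable_entry i h)).1.
have DD (z y : V) : differentiable ('D_z f) p ->
    'D_y ('D_z f) p 0 i = 'D_y ('D_z (fun q => f q 0 i : R)) p.
  move=> h; have /is_derive_rowP/(_ i) h1 := differentiable_is_derive y h.
  have h2 := near_eq_is_derive (nD z) h1.
  exact: (esym (@derive_val _ _ _ _ _ _ _ h2)).
apply: (etrans (DD v w dv)); apply: (etrans _ (esym (DD w v dw))).
apply: (derive_symmetric oU Up) => [q Uq| |]; [|exact: dD|exact: dD].
exact: differentiable_entry (df q Uq).
Qed.

Variables (S : topologicalType) (A : set (chart R S)) (x n : S -> 'rV[R]_3).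
Hypothesis hx : immersed_surface A x n.

(** Differentiating <m, D_z f> = 0 along v identifies <D_v m, D_z f> with
    - <m, D_v D_z f>, which is symmetric in v and z. *)
Lemma atlas_germ psi w : A psi -> pdom psi w ->
  surface_germ (x \o param psi) (n \o param psi) w.
Proof.
move=> Apsi hw; have [_ [xs inj] [ns nn nx]] := hx.
set f := x \o param psi; set m := n \o param psi.
have oU : open (pdom psi) by exact: pdom_open.
have nU := near_open oU hw.
have df q : pdom psi q -> differentiable f q by exact: (xs psi Apsi [::] q).
have dm q : pdom psi q -> differentiable m q by exact: (ns psi Apsi [::] q).
have ddf v q : pdom psi q -> differentiable ('D_v f) q by exact: (xs psi Apsi [:: v] q).
have mf v q : pdom psi q -> dot (m q) ('D_v f q) = 0.
  move=> hq; have e : 'D_v f q = 'd f q v by exact: (deriveE v (df q hq)).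
  by rewrite e; exact: nx.
have eD v : 'D_v f w = 'd f w v by exact: (deriveE v (df w hw)).
have eM v : 'D_v m w = 'd m w v by exact: (deriveE v (dm w hw)).
have dfw v := differentiable_is_derive v (df w hw).
have dmw v := differentiable_is_derive v (dm w hw).
have mdm v : dot (m w) ('D_v m w) = 0.
  have : dot ('D_v m w) (m w) + dot (m w) ('D_v m w) = 0.
    apply: (is_derive_near_unique _ (is_derive_dot (dmw v) (dmw v)) (is_derive_cst (1 : R) w v)).
    by apply: filterS nU => q _; exact: nn.
  by rewrite (dotC ('D_v m w)); lra.
have sym v z : dot ('D_v m w) ('D_z f w) = - dot (m w) ('D_v ('D_z f) w).
  have h := differentiable_is_derive v (ddf z w hw).
  have : dot ('D_v m w) ('D_z f w) + dot (m w) ('D_v ('D_z f) w) = 0.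
    apply: (is_derive_near_unique _ (is_derive_dot (dmw v) h) (is_derive_cst (0 : R) w v)).
    by apply: filterS nU => q; exact: mf.
  by move/eqP; rewrite addr_eq0 => /eqP.
apply: SurfaceGerm.
- exact: df.
- exact: dm.
- exact: (inj psi w Apsi hw).
- exact: nn.
- by move=> v; exact: nx.
- by move=> v; exact: (etrans (congr1 (dot (m w)) (esym (eM v))) (mdm v)).
- move=> v z; have e : dot ('D_v f w) ('D_z m w) = dot ('D_z f w) ('D_v m w).
    have swap := derive_symmetric_row oU hw df (ddf v w hw) (ddf z w hw).
    apply: (etrans (dotC _ _)); apply: (etrans (sym z v)).
    apply: (etrans (congr1 (fun y => - dot (m w) y) swap)).
    exact: (etrans (esym (sym v z)) (dotC _ _)).
  exact: (etrans (esym (congr2 (@dot R) (eD v) (eM z)))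
    (etrans e (congr2 (@dot R) (eD z) (eM v)))).
Qed.

Lemma char_poly2 (M : 'M[R]_2) (k1 k2 : R) :
  char_poly M = ('X - k1%:P) * ('X - k2%:P) -> \tr M = k1 + k2 /\ \det M = k1 * k2.
Proof.
move=> E; have h1 := char_poly_trace M isT; have h2 := char_poly_det M.
rewrite E in h1 h2; split.
  apply: oppr_inj; rewrite -h1 coefM !big_ord_recl big_ord0 /= !coefB !coefX !coefC /=.
  by ring.
rewrite coefM !big_ord_recl big_ord0 /= !coefB !coefX !coefC /= in h2.
by move: h2; rewrite expr2; lra.
Qed.

End AtlasGerm.

(** * Transport to the foliated charts *)
Section Transitions.
Variables (R : realType) (S : topologicalType).
Implicit Types (phi psi : chart R S).

Lemma near_eq_continuous (T U : topologicalType) (f g : T -> U) (p : T) :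
  (\forall q \near p, f q = g q) -> {for p, continuous f} -> {for p, continuous g}.
Proof.
move=> fg cf; suff : g q @[q --> p] --> g p by [].
rewrite -(nbhs_singleton fg); apply: cvg_trans cf.
exact: near_eq_cvg.
Qed.

Lemma param_continuous_at phi u : pdom phi u -> {for u, continuous (param phi)}.
Proof.
move=> hu; have := param_continuous (c := phi).
rewrite continuous_open_subspace; last exact: pdom_open.
by apply; rewrite inE.
Qed.

Lemma coords_continuous_at phi p : (param phi @` pdom phi) p ->
  {for p, continuous (coords phi)}.
Proof.
move=> hu; have := coords_continuous (c := phi).
rewrite continuous_open_subspace; last exact: range_open.
by apply; rewrite inE.
Qed.

Lemma overlap_near phi psi u : overlap phi psi u ->
  \forall q \near u, overlap phi psi q.
Proof.
move=> [hu hpsi]; have h1 : \forall q \near u, pdom phi q.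
  by apply: near_open => //; exact: pdom_open.
have h2 : \forall p \near param phi u, (param psi @` pdom psi) p.
  by apply: near_open => //; exact: range_open.
have h3 : \forall q \near u, (param psi @` pdom psi) (param phi q).
  have cp : param phi q @[q --> u] --> param phi u by exact: param_continuous_at.
  exact: (cp _ h2).
by apply: filterS2 h1 h3.
Qed.

Lemma transition_spec phi psi q : overlap phi psi q ->
  [/\ param psi (transition phi psi q) = param phi q,
      overlap psi phi (transition phi psi q)
    & transition psi phi (transition phi psi q) = q].
Proof.
move=> [hq [w hw e]].
have E : transition phi psi q = w by rewrite /transition /= -e paramK.
rewrite E; split=> //.
  by split=> //; exists q.
by rewrite /transition /= e paramK.
Qed.

Lemma transition_differential phi psi u : compatible phi psi -> overlap phi psi u ->
  [/\ differentiable (transition phi psi) u,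
    injective ('d (transition phi psi) u) & 'J (transition phi psi) u \in unitmx].
Proof.
move=> [c1 c2] ou; have [_ ou' E] := transition_spec ou.
have d1 : differentiable (transition phi psi) u by exact: (c1 [::] u ou).
have d2 : differentiable (transition psi phi) (transition phi psi u).
  exact: (c2 [::] _ ou').
have near_id : \forall q \near u, id q = (transition psi phi \o transition phi psi) q.
  by apply: filterS (overlap_near ou) => q /transition_spec[_ _].
have did : differentiable (id : 'rV[R]_2 -> 'rV[R]_2) u by [].
have did_val : ('d (id : 'rV[R]_2 -> 'rV[R]_2) u : _ -> _) = id by rewrite diff_val.
have [_ D] := near_eq_diff near_id did.
have K v : 'd (transition psi phi) (transition phi psi u) ('d (transition phi psi) u v) = v.
  apply: (etrans (esym (diff_comp_at v d1 d2))); apply: (etrans (D v)).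
  exact: (congr1 (fun h => h v) did_val).
split; first exact: d1.
- by move=> v w h; exact: (etrans (esym (K v)) (etrans (congr1 _ h) (K w))).
- have JJ : 'J (transition phi psi) u *m 'J (transition psi phi) (transition phi psi u) = 1%:M.
    apply/row_matrixP => i; rewrite row_mul !rowE mulmx1.
    apply: (etrans (congr1 (mulmx^~ _) (mul_rV_lin1 _ _))).
    exact: (etrans (mul_rV_lin1 _ _) (K _)).
  exact: (mulmx1_unit JJ).1.
Qed.

Variables (A F : set (chart R S)) (x n : S -> 'rV[R]_3) (k1 k2 : S -> R).
Hypothesis hx : immersed_surface A x n.
Hypothesis hk : principal_curvatures A x n k1 k2.
Hypothesis hF : foliated_atlas A F.
Hypothesis hlines : consists_of_curvature_lines x n F.

Local Notation e0 := (delta_mx 0 0 : 'rV[R]_2).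
Local Notation e1 := (delta_mx 0 1 : 'rV[R]_2).

Lemma atlas_chart_at phi u : F phi -> pdom phi u ->
  exists psi, [/\ A psi, compatible phi psi & overlap phi psi u].
Proof.
move=> Fphi hu; have [[_ _ _ [cov _]] _ _] := hx; have [_ _ comp _] := hF.
have [psi Apsi hpsi] := cov (param phi u).
by exists psi; split=> //; exact: comp.
Qed.

Lemma leaf_germ phi u psi : A psi -> compatible phi psi -> overlap phi psi u ->
  let tau := transition phi psi in
  [/\ surface_germ (x \o param phi) (n \o param phi) u,
    (forall v, 'd (x \o param phi) u v = 'd (x \o param psi) (tau u) ('d tau u v))
  & (forall v, 'd (n \o param phi) u v = 'd (n \o param psi) (tau u) ('d tau u v))].
Proof.
move=> Apsi comp ou tau.
have [e [hw _] _] := transition_spec ou.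
have [dt inj _] := transition_differential comp ou.
have nE (y : S -> 'rV[R]_3) :
    \forall q \near u, (y \o param phi) q = (y \o param psi) (tau q).
  by apply: filterS (overlap_near ou) => q /transition_spec[/= -> _ _].
have [h1 [h2 h3]] := germ_pullback (atlas_germ hx Apsi hw) dt inj (nE x) (nE n).
by split; [exact: h1|exact: h2|exact: h3].
Qed.

Lemma leaf_principal phi u : F phi -> pdom phi u ->
  surface_germ (x \o param phi) (n \o param phi) u /\
  exists kl : R * R, exists al, [/\
    'd (n \o param phi) u e0 = - kl.1 *: 'd (x \o param phi) u e0,
    'd (n \o param phi) u e1 + kl.2 *: 'd (x \o param phi) u e1 =
      al *: 'd (x \o param phi) u e0,
    kl.1 + kl.2 = k1 (param phi u) + k2 (param phi u)
  & kl.1 * kl.2 = k1 (param phi u) * k2 (param phi u)].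
Proof.
move=> Fphi hu; have [psi [Apsi comp ou]] := atlas_chart_at Fphi hu.
have [G EX EN] := leaf_germ Apsi comp ou; split; first exact: G.
have [ep [hw _] _] := transition_spec ou.
have [dt inj Ju] := transition_differential comp ou.
have [tr_eq det_eq] := shape_pullback (gram_unit (atlas_germ hx Apsi hw)) Ju
  (jacobian_pullback EX) (jacobian_pullback EN).
have [k hkk] := hlines Fphi hu.
have [l [al [h1 h2 h3 h4]]] := germ_principal G hkk.
have [t1 t2] := char_poly2 (hk Apsi hw).
exists (k, l), al; split; [exact: h1|exact: h2| |].
- by rewrite /= -h3 tr_eq -ep; exact: t1.
- by rewrite /= -h4 det_eq -ep; exact: t2.
Qed.

Lemma linear_basis (D : {linear 'rV[R]_2 -> 'rV[R]_3}) z :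
  D z = z 0 0 *: D e0 + z 0 1 *: D e1.
Proof. by rewrite {1}[z]delta_mx_basis linearD !linearZ. Qed.

(** The speed of the state across the leaves has to be continuous to have an
    antiderivative.  Near u the vector x_t is a combination of continuous partial
    derivatives in a chart of the atlas, with the derivatives of the transition
    map as coefficients. *)
Lemma leaf_transverse_continuous phi u : F phi -> pdom phi u ->
  {for u, continuous (fun q => 'd (x \o param phi) q e1)}.
Proof.
move=> Fphi hu; have [psi [Apsi comp ou]] := atlas_chart_at Fphi hu.
pose tau := transition phi psi; pose f := x \o param psi.
have [_ [xs _] _] := hx.
have [_ ow _] := transition_spec ou; have [hw _] := ow.
have oV : open (pdom psi) by exact: pdom_open.
have ct : {for u, continuous tau}.
  by apply: differentiable_continuous; exact: (comp.1 [::] u ou).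
have cdt : {for u, continuous ('D_e1 tau)}.
  by apply: differentiable_continuous; exact: (comp.1 [:: e1] u ou).
have cdf (v : 'rV[R]_2) : {for u, continuous (fun q => 'D_v f (tau q))}.
  have : {for tau u, continuous ('D_v f)}.
    by apply: differentiable_continuous; exact: (xs psi Apsi [:: v] _ hw).
  by move=> h; exact: (cvg_comp _ _ ct h).
apply: (@near_eq_continuous _ _ (fun q => 'D_e1 tau q 0 0 *: 'D_e0 f (tau q)
    + 'D_e1 tau q 0 1 *: 'D_e1 f (tau q))).
  apply: filterS (overlap_near ou) => q oq.
  have [_ EX _] := leaf_germ Apsi comp oq.
  have [_ [hwq _] _] := transition_spec oq.
  have dtq : differentiable tau q by exact: (comp.1 [::] q oq).
  have dfq : differentiable f (tau q) by exact: (xs psi Apsi [::] _ hwq).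
  apply: (etrans _ (esym (EX e1))).
  have Et : 'D_e1 tau q = 'd tau q e1 by exact: (deriveE e1 dtq).
  have Ef v : 'D_v f (tau q) = 'd f (tau q) v by exact: (deriveE v dfq).
  rewrite Et; move: ('d tau q e1) => z.
  apply: (etrans (congr2 (fun y y' => z 0 0 *: y + z 0 1 *: y') (Ef e0) (Ef e1))).
  exact: (esym (linear_basis ('d f (tau q)) z)).
have coord (i : 'I_2) : {for u, continuous (fun q => 'D_e1 tau q 0 i)}.
  exact: (cvg_comp _ _ cdt (@coord_continuous _ _ _ 0 i _)).
have c0 := cvgZ (FF := nbhs_filter u) (coord 0) (cdf e0); have c1 := cvgZ (FF := nbhs_filter u) (coord 1) (cdf e1).
exact: (cvgD (FF := nbhs_filter u) c0 c1).
Qed.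

End Transitions.

(** * Foliated charts are linear Weingarten patches *)
Section LeafPatch.
Variables (R : realType) (S : topologicalType).
Variables (A F : set (chart R S)) (x n : S -> 'rV[R]_3) (k1 k2 : S -> R).
Hypothesis hx : immersed_surface A x n.
Hypothesis hk : principal_curvatures A x n k1 k2.
Hypothesis hF : foliated_atlas A F.
Hypothesis hlines : consists_of_curvature_lines x n F.
Variables (a b c : R).
Hypothesis hW : forall p,
  a * gauss_curvature k1 k2 p + 2 * b * mean_curvature k1 k2 p + c = 0.

Local Notation e0 := (delta_mx 0 0 : 'rV[R]_2).
Local Notation e1 := (delta_mx 0 1 : 'rV[R]_2).

Lemma row2_line0 (s t : R) : row2 s t = row2 0 t + s *: e0.
Proof.
rewrite [RHS]row2_eta !mxE /=; congr row2; first by rewrite mulr1 add0r.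
by rewrite mulr0 addr0.
Qed.

Lemma row2_line1 (s t : R) : row2 s t = row2 s 0 + t *: e1.
Proof.
rewrite [RHS]row2_eta !mxE /=; congr row2; first by rewrite mulr0 addr0.
by rewrite mulr1 add0r.
Qed.

Lemma is_derive_slice0 (f : 'rV[R]_2 -> 'rV[R]_3) (s t : R) :
  differentiable f (row2 s t) ->
  is_derive s 1 (fun s => f (row2 s t)) ('d f (row2 s t) e0).
Proof.
move=> df; have -> : (fun s => f (row2 s t)) = (fun s => f (row2 0 t + s *: e0)).
  by apply/funext => r; rewrite -row2_line0.
apply: is_derive_line; rewrite -row2_line0.
apply: (is_derive_val (differentiable_is_derive e0 df)); exact: (deriveE e0 df).
Qed.

Lemma is_derive_slice1 (f : 'rV[R]_2 -> 'rV[R]_3) (s t : R) :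
  differentiable f (row2 s t) ->
  is_derive t 1 (fun t => f (row2 s t)) ('d f (row2 s t) e1).
Proof.
move=> df; have -> : (fun t => f (row2 s t)) = (fun t => f (row2 s 0 + t *: e1)).
  by apply/funext => r; rewrite -row2_line1.
apply: is_derive_line; rewrite -row2_line1.
apply: (is_derive_val (differentiable_is_derive e1 df)); exact: (deriveE e1 df).
Qed.

Lemma leaf_patch phi a0 b0 a1 b1 : F phi ->
  pdom phi = [set u | a0 < u 0 0 < b0 /\ a1 < u 0 1 < b1] ->
  exists Xs Xt Nt kappa lam, lw_patch a b c a0 b0 a1 b1
    (fun s t => x (param phi (row2 s t))) (fun s t => n (param phi (row2 s t)))
    Xs Xt Nt kappa lam
  /\ forall s t, a0 < s < b0 -> a1 < t < b1 -> let p := param phi (row2 s t) in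
     kappa s t + lam s t = k1 p + k2 p /\ kappa s t * lam s t = k1 p * k2 p.
Proof.
move=> Fphi dom; have inbox s t : a0 < s < b0 -> a1 < t < b1 -> pdom phi (row2 s t).
  by move=> hs ht; rewrite dom /= !row2E.
pose X := x \o param phi; pose N := n \o param phi.
have ex u : exists kl : R * R, pdom phi u -> exists al, [/\
    'd N u e0 = - kl.1 *: 'd X u e0,
    'd N u e1 + kl.2 *: 'd X u e1 = al *: 'd X u e0,
    kl.1 + kl.2 = k1 (param phi u) + k2 (param phi u)
  & kl.1 * kl.2 = k1 (param phi u) * k2 (param phi u)].
  have [hu|hu] := pselect (pdom phi u); last by exists (0, 0).
  have [_ [kl h]] := leaf_principal hx hk hF hlines Fphi hu.
  by exists kl => _; exact: h.
have [kl hkl] := choice ex.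
have G u : pdom phi u -> surface_germ X N u.
  by move=> hu; exact: (leaf_principal hx hk hF hlines Fphi hu).1.
exists (fun s t => 'd X (row2 s t) e0), (fun s t => 'd X (row2 s t) e1),
  (fun s t => 'd N (row2 s t) e1), (fun s t => (kl (row2 s t)).1),
  (fun s t => (kl (row2 s t)).2); split; last first.
  by move=> s t hs ht p; have [al [_ _]] := hkl _ (inbox _ _ hs ht).
have Gb s t : a0 < s < b0 -> a1 < t < b1 -> surface_germ X N (row2 s t).
  by move=> hs ht; exact: G (inbox s t hs ht).
split.
- by move=> s t hs ht; exact: (is_derive_slice0 (germ_X (Gb s t hs ht))).
- by move=> s t hs ht; exact: (is_derive_slice1 (germ_X (Gb s t hs ht))).
- move=> s t hs ht; have [al [h1 _ _ _]] := hkl _ (inbox s t hs ht).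
  exact: (is_derive_val (is_derive_slice0 (germ_N (Gb s t hs ht))) h1).
- by move=> s t hs ht; exact: (is_derive_slice1 (germ_N (Gb s t hs ht))).
- move=> s t hs ht; have cr : {for t, continuous (row2 s)}.
    exact: (is_derive_continuous (is_derive_row2 (is_derive_cst s t 1) (is_derive_id t 1))).
  have cX := leaf_transverse_continuous hx hF Fphi (inbox s t hs ht).
  exact: (cvg_comp _ _ cr cX).
- by move=> s t hs ht; exact: (germ_independent (Gb s t hs ht)).
- by move=> s t hs ht; exact: (germ_unit (Gb s t hs ht)).
- by move=> s t hs ht; exact: (germ_normal (Gb s t hs ht)).
- by move=> s t hs ht; exact: (germ_normal (Gb s t hs ht)).
- move=> s t hs ht; have [al [_ h2 _ _]] := hkl _ (inbox s t hs ht).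
  by exists al; exact: h2.
- move=> s t hs ht; have [al [_ _ h3 h4]] := hkl _ (inbox s t hs ht).
  rewrite h3 h4 -[RHS](hW (param phi (row2 s t))) /gauss_curvature /mean_curvature.
  by field.
Qed.

End LeafPatch.

(** * Polar coordinates and connectedness *)
Section Misc.
Variable R : realType.

Lemma polar (al be : R) : al ^+ 2 + be ^+ 2 = 1 ->
  exists theta, cos theta = al /\ sin theta = be.
Proof.
move=> h; have al1 : -1 <= al <= 1.
  by rewrite -ler_norml -sqrtr_sqr -sqrtr1 ler_sqrt// -h lerDl sqr_ge0.
have s : Num.sqrt (1 - al ^+ 2) = `|be| by rewrite -h addrC addKr sqrtr_sqr.
have [b0|b0] := leP 0 be.
  by exists (acos al); rewrite acosK ?in_itv// sin_acos// s ger0_norm.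
exists (- acos al); rewrite cosN sinN acosK ?in_itv// sin_acos// s.
by rewrite ltr0_norm ?opprK.
Qed.

Lemma polar_frame (e1 e2 e3 v : 'rV[R]_3) : orthonormal3 e1 e2 e3 -> dot v e3 = 0 ->
  exists theta, v = (Num.sqrt (dot v v) * cos theta) *: e1
    + (Num.sqrt (dot v v) * sin theta) *: e2.
Proof.
move=> [[h1 h2 h12] h3 h13 h23] v3.
have e30 : e3 != 0.
  by apply/eqP => e; move: h3; rewrite e dot0l => /esym/eqP; rewrite oner_eq0.
have c0 : cross e1 e2 != 0.
  apply: (@cross_neq0_orth _ e1 e2 1) => //; last by rewrite h1 expr1n.
have E : v = dot v e1 *: e1 + dot v e2 *: e2.
  apply/eqP; rewrite -subr_eq0; apply/eqP.
  apply: (orth_frame c0 e30); rewrite ?(dotC e3) ?h13 ?h23//.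
  - by rewrite dotDl dotNl dotDl !dotZl v3 h13 h23; ring.
  - by rewrite dotDl dotNl dotDl !dotZl h1 (dotC e2) h12; ring.
  - by rewrite dotDl dotNl dotDl !dotZl h2 h12; ring.
have V : dot v v = dot v e1 ^+ 2 + dot v e2 ^+ 2.
  by rewrite {2}E dotDr !dotZr; ring.
have [r0|r0] := eqVneq (dot v v) 0.
  by exists 0; rewrite r0 sqrtr0 !mul0r !scale0r addr0; exact: dot_eq0.
have rp : 0 < Num.sqrt (dot v v) by rewrite sqrtr_gt0 lt0r r0 dot_ge0.
have rne := lt0r_neq0 rp; have ss := sqr_sqrtr (dot_ge0 v).
set rho := Num.sqrt _ in rp rne ss *.
have [|th [hc hs]] := @polar (dot v e1 / rho) (dot v e2 / rho).
  by rewrite !expr_div_n -mulrDl -V ss mulfV.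
exists th; rewrite hc hs [LHS]E; congr (_ *: _ + _ *: _).
  by rewrite mulrCA mulfV// mulr1.
by rewrite mulrCA mulfV// mulr1.
Qed.

Lemma circle_on_circle (Z : set 'rV[R]_3) : circle Z ->
  exists C B r, [/\ 0 < r, dot B B = 1 & forall y, Z y -> on_circle C B r y].
Proof.
move=> [C [e1 [e2 [r [r0 [h1 h2 h12] EZ]]]]]; rewrite EZ {Z EZ}.
exists C, (cross e1 e2), r; split=> //; first by rewrite cross_norm2 h1 h2 h12; ring.
move=> y [th _ <-]; rewrite /on_circle.
have -> : C + (r * cos th) *: e1 + (r * sin th) *: e2 - C =
    (r * cos th) *: e1 + (r * sin th) *: e2 by rewrite addrAC [C + _]addrC addrK.
split.
  rewrite dotDl !dotDr !dotZl !dotZr h1 h2 (dotC e2) h12.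
  transitivity (r ^+ 2 * (cos th ^+ 2 + sin th ^+ 2)); first by ring.
  by rewrite cos2Dsin2 mulr1.
by rewrite dotC dotDr !dotZr dot_crossl dot_crossr; ring.
Qed.

Lemma connected_locally_constant (S : topologicalType) (T : Type) (f : S -> T) :
  connected [set: S] -> (forall p, \forall q \near p, f q = f p) ->
  forall p q, f p = f q.
Proof.
move=> cS lc p q; pose B := [set z | f z = f p].
suff BT : B = [set: S] by have : [set: S] q by []; rewrite -BT => ->.
have oB : open B.
  by rewrite openE => z Bz; apply: filterS (lc z) => y yz; rewrite /B /= yz.
apply: cS; first by exists p.
  by exists B => //; rewrite setTI.
exists B; last by rewrite setTI.
rewrite -openC openE => z Bz; apply: filterS (lc z) => y yz.
by rewrite /B /= yz.
Qed.

End Misc.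

(** * The circle through a point of the surface *)
Section Global.
Variables (R : realType) (S : topologicalType).
Variables (A F : set (chart R S)) (x n : S -> 'rV[R]_3) (k1 k2 : S -> R).
Hypothesis hx : immersed_surface A x n.
Hypothesis hk : principal_curvatures A x n k1 k2.
Hypothesis hF : foliated_atlas A F.
Hypothesis hlines : consists_of_curvature_lines x n F.

Definition leaf_circle (p : S) C B r := [/\ 0 < r, dot B B = 1 &
  exists phi u, [/\ F phi, pdom phi u, param phi u = p &
    forall u', pdom phi u' -> u' 0 1 = u 0 1 -> on_circle C B r (x (param phi u'))]].

Lemma leaf_circleN p C B r : leaf_circle p C B r -> leaf_circle p C (- B) r.
Proof.
move=> [r0 BB [phi [u [Fphi hu e H]]]]; split=> //; first by rewrite !dotL BB opprK.
exists phi, u; split=> // u' hu' e'; have [h1 h2] := H u' hu' e'.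
by split; rewrite // dotNr h2 oppr0.
Qed.

Local Notation e0 := (delta_mx 0 0 : 'rV[R]_2).

Lemma slice_near (u : 'rV[R]_2) (P : 'rV[R]_2 -> Prop) :
  (\forall q \near u, P q) -> \forall s \near u 0 0, P (row2 s (u 0 1)).
Proof.
move=> h; have cr : {for u 0 0, continuous (fun s => row2 s (u 0 1))}.
  exact: (is_derive_continuous (is_derive_row2 (is_derive_id (u 0 0) 1)
    (is_derive_cst (u 0 1) (u 0 0) 1))).
by move: h; rewrite {1}(row2_eta u) => h; exact: (cr _ h).
Qed.

(** Only foliated charts and charts of the atlas are assumed compatible, hence
    the detour through a chart chi of the atlas. *)
Lemma leaf_transition_differentiable phi psi u : F phi -> F psi -> overlap phi psi u ->
  differentiable (transition phi psi) u.
Proof.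
move=> Fphi Fpsi ou; have [hu _] := ou.
have [chi [Achi comp1 ou1]] := atlas_chart_at hx hF Fphi hu.
have [_ _ comp _] := hF; have comp2 := comp psi chi Fpsi Achi.
have [e1 o1 _] := transition_spec ou1; have [e _ _] := transition_spec ou.
have ou2 : overlap chi psi (transition phi chi u).
  by split; [case: o1|rewrite /= e1; case: ou].
have d1 : differentiable (transition phi chi) u by exact: (comp1.1 [::] u ou1).
have d2 : differentiable (transition chi psi) (transition phi chi u).
  exact: (comp2.2 [::] _ ou2).
have nE : \forall q \near u, (transition chi psi \o transition phi chi) q =
    transition phi psi q.
  apply: filterS (overlap_near ou1) => q /transition_spec[eq _ _].
  by rewrite /transition /= in eq *; rewrite eq.
exact: (near_eq_diff nE (differentiable_comp d1 d2)).1.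
Qed.

Lemma leaf_transition_slice phi psi u : F phi -> F psi -> overlap phi psi u ->
  \forall s \near u 0 0, overlap phi psi (row2 s (u 0 1)) /\
    transition phi psi (row2 s (u 0 1)) 0 1 = transition phi psi u 0 1.
Proof.
move=> Fphi Fpsi ou; have no := slice_near (overlap_near ou).
pose f s := transition phi psi (row2 s (u 0 1)) 0 1.
have : \forall s \near u 0 0, f s = f (u 0 0).
  apply: constant_near; apply: filterS no => s os.
  have dt := leaf_transition_differentiable Fphi Fpsi os.
  have [_ _ _ /(_ phi psi _ Fphi Fpsi os) J0] := hF.
  have E : (fun s => transition phi psi (row2 s (u 0 1))) =
      (fun s => transition phi psi (row2 0 (u 0 1) + s *: e0)).
    by apply/funext => r; rewrite -row2_line0.
  have h : is_derive s 1 (fun s => transition phi psi (row2 s (u 0 1)))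
      ('D_e0 (transition phi psi) (row2 s (u 0 1))).
    rewrite E; apply: is_derive_line; rewrite -row2_line0.
    exact: (differentiable_is_derive e0 dt).
  have /is_derive_rowP/(_ 1) h1 := h.
  apply: (is_derive_val h1).
  have -> : 'D_e0 (transition phi psi) (row2 s (u 0 1)) =
      e0 *m 'J (transition phi psi) (row2 s (u 0 1)).
    exact: (deriveEjacobian e0 dt).
  by rewrite -rowE /row mxE.
apply: filterS2 no => s os; rewrite /f -row2_eta => e; split; [exact: os|exact: e].
Qed.

(** The leaves through p in two foliated charts share an arc, because the
    transition map keeps the second coordinate along a leaf.  Three points of
    that arc determine the circle, up to the orientation of its axis. *)
Lemma leaf_circle_unique p C B r C' B' r' :
  leaf_circle p C B r -> leaf_circle p C' B' r' ->
  [/\ C' = C, r' = r & B' = B \/ B' = - B].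
Proof.
move=> [r0 BB [phi [u [Fphi hu eu H]]]] [r0' BB' [psi [w [Fpsi hw ew H']]]].
have ou : overlap phi psi u by split => //; rewrite /= eu -ew; exists w.
have /nbhs_ballP[e /= e_gt0 he] := leaf_transition_slice Fphi Fpsi ou.
have tw : transition phi psi u = w by rewrite /transition /= eu -ew paramK.
have G := (leaf_principal hx hk hF hlines Fphi hu).1.
have X0 : 'd (x \o param phi) u e0 != 0.
  apply: contraNneq (germ_independent G) => h.
  by apply/eqP; exact: (etrans (congr1 (fun y => cross y _) h) (cross0l _)).
have dX : is_derive (u 0 0) 1 (fun s => x (param phi (row2 s (u 0 1))))
    ('d (x \o param phi) u e0).
  have G' : surface_germ (x \o param phi) (n \o param phi) (row2 (u 0 0) (u 0 1)).
    by rewrite -row2_eta.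
  have := is_derive_slice0 (germ_X G'); rewrite -row2_eta; exact.
have [|s [hs [s10 s20 s12]]] := three_points (a := u 0 0 - e) (b := u 0 0 + e) _ X0 dX.
  by lra.
have on1 i : on_circle C B r (x (param phi (row2 (s i) (u 0 1)))).
  have [|[h _] _] := he (s i); first by rewrite /ball/= ltr_distlC; exact: hs.
  by apply: H => //; rewrite row2E.
have on2 i : on_circle C' B' r' (x (param phi (row2 (s i) (u 0 1)))).
  have [|oi ti] := he (s i); first by rewrite /ball/= ltr_distlC; exact: hs.
  have [e1 [h _] _] := transition_spec oi.
  by rewrite -e1; apply: H'; [exact: h|rewrite ti tw].
have a0 := axis3_neq0 (on1 0) (on1 1) (on1 2) s10 s20 s12.
have [-> -> h1] := circle3 r0 BB (on1 0) (on1 1) (on1 2) a0.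
have [-> -> h2] := circle3 r0' BB' (on2 0) (on2 1) (on2 2) a0.
split=> //; case: h1 h2 => -> [] ->; [by left|by right|by right; rewrite opprK|by left].
Qed.

End Global.

(** * The common axis *)
Section Revolution.
Variables (R : realType) (S : topologicalType).
Variables (A F : set (chart R S)) (x n : S -> 'rV[R]_3) (k1 k2 : S -> R).
Hypothesis hx : immersed_surface A x n.
Hypothesis hk : principal_curvatures A x n k1 k2.
Hypothesis hF : foliated_atlas A F.
Hypothesis hlines : consists_of_curvature_lines x n F.
Hypothesis hcirc : consists_of_circular_arcs x F.
Variables (a b c : R).
Hypothesis hW : forall p,
  a * gauss_curvature k1 k2 p + 2 * b * mean_curvature k1 k2 p + c = 0.
Hypothesis discriminant_neq0 : discriminant a b c != 0.

Local Notation leaf_circle := (leaf_circle F x).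
Local Notation circle_unique := (leaf_circle_unique hx hk hF hlines).

Lemma leaf_chart (p : S) : exists phi a0 b0 a1 b1 s0 t0 Xs Xt Nt kappa lam,
  [/\ F phi, pdom phi = [set u | a0 < u 0 0 < b0 /\ a1 < u 0 1 < b1],
    param phi (row2 s0 t0) = p /\ (a0 < s0 < b0 /\ a1 < t0 < b1),
    lw_patch a b c a0 b0 a1 b1
    (fun s t => x (param phi (row2 s t))) (fun s t => n (param phi (row2 s t)))
    Xs Xt Nt kappa lam
  & forall s t, a0 < s < b0 -> a1 < t < b1 -> let p := param phi (row2 s t) in
     kappa s t + lam s t = k1 p + k2 p /\ kappa s t * lam s t = k1 p * k2 p].
Proof.
have [cov box _ _] := hF; have [phi Fphi [u hu eu]] := cov p.
have [a0 [b0 [a1 [b1 dom]]]] := box phi Fphi.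
have [Xs [Xt [Nt [ka [la [P H]]]]]] := leaf_patch hx hk hF hlines hW Fphi dom.
exists phi, a0, b0, a1, b1, (u 0 0), (u 0 1), Xs, Xt, Nt, ka, la.
split; [exact: Fphi|exact: dom| |exact: P|exact: H].
by rewrite -row2_eta; split=> //; move: hu; rewrite dom.
Qed.

Lemma leaf_chart_near (phi : chart R S) a0 b0 a1 b1 s0 t0 (P : R -> Prop) :
  pdom phi = [set u | a0 < u 0 0 < b0 /\ a1 < u 0 1 < b1] ->
  a0 < s0 < b0 -> a1 < t0 < b1 -> (\forall t \near t0, P t) ->
  \forall q \near param phi (row2 s0 t0), exists s t,
    [/\ a0 < s < b0, a1 < t < b1, param phi (row2 s t) = q,
      coords phi q = row2 s t & P t].
Proof.
move=> dom hs ht hP; set p := param phi _.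
have hu : pdom phi (row2 s0 t0) by rewrite dom /= !row2E.
have hp : (param phi @` pdom phi) p by exists (row2 s0 t0).
have nr : \forall q \near p, (param phi @` pdom phi) q.
  by apply: near_open => //; exact: range_open.
have nP : \forall q \near p, P (coords phi q 0 1).
  have cc : {for p, continuous (fun q => coords phi q 0 1)}.
    exact: (cvg_comp _ _ (coords_continuous_at hp) (@coord_continuous _ _ _ 0 1 _)).
  apply: (cc P); rewrite /= paramK// row2E; exact: hP.
apply: filterS2 nr nP => q [u hu' e] Pq.
rewrite -e paramK// in Pq *; exists (u 0 0), (u 0 1); rewrite -row2_eta.
by have [h1 h2] : a0 < u 0 0 < b0 /\ a1 < u 0 1 < b1 by move: hu'; rewrite dom.
Qed.

Section Chart.
Variables (phi : chart R S) (a0 b0 a1 b1 : R).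
Hypothesis Fphi : F phi.
Hypothesis dom : pdom phi = [set u | a0 < u 0 0 < b0 /\ a1 < u 0 1 < b1].
Local Notation X := (fun s t => x (param phi (row2 s t))).

Lemma chart_circular t : a1 < t < b1 -> exists C B r, circular_leaf a0 b0 X t C B r.
Proof.
move=> ht; have [Z /circle_on_circle[C [B [r [r0 BB H]]]] hZ] := hcirc t Fphi.
exists C, B, r; split=> // s hs; apply: H; apply: hZ; last by rewrite row2E.
by rewrite dom /= !row2E.
Qed.

Lemma circular_leaf_circle s t C B r : a0 < s < b0 -> a1 < t < b1 ->
  circular_leaf a0 b0 X t C B r -> leaf_circle (param phi (row2 s t)) C B r.
Proof.
move=> hs ht [r0 BB H]; split=> //; exists phi, (row2 s t); split=> //.
  by rewrite dom /= !row2E.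
move=> u'; rewrite dom /= row2E => -[h1 h2] e.
by rewrite (row2_eta u') e; exact: H.
Qed.

End Chart.

Lemma leaf_circle_exists p : exists CBr : 'rV[R]_3 * 'rV[R]_3 * R,
  leaf_circle p CBr.1.1 CBr.1.2 CBr.2.
Proof.
have [phi [a0 [b0 [a1 [b1 [s0 [t0 [Xs [Xt [Nt [ka [la
  [Fphi dom [<- [hs ht]] P H]]]]]]]]]]]]] := leaf_chart p.
have [C [B [r cl]]] := chart_circular Fphi dom ht.
by exists (C, B, r); exact: (circular_leaf_circle Fphi dom hs ht cl).
Qed.

Section LeafData.
Variables (C B : S -> 'rV[R]_3) (r : S -> R).
Hypothesis hleaf : forall p, leaf_circle p (C p) (B p) (r p).

Definition leaf_curvature p := - (dot (n p) (x p - C p) / r p ^+ 2).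
Definition leaf_integral p := first_integral a b c (leaf_curvature p) (r p).
(** The projector onto the axis direction does not see the sign of B. *)
Definition axis_projector p : 'M[R]_3 := (B p)^T *m B p.
(** The point of the axis line closest to the origin. *)
Definition axis_foot p := C p - dot (C p) (B p) *: B p.

(** Transfers [patch_axis] to the surface: C, B and r are arbitrary choices at
    each point, but the three quantities do not depend on them. *)
Lemma leaf_data_near p : \forall q \near p, leaf_integral q = leaf_integral p /\
  (leaf_integral p != 0 -> axis_projector q = axis_projector p /\
   axis_foot q = axis_foot p).
Proof.
have [phi [a0 [b0 [a1 [b1 [s0 [t0 [Xs [Xt [Nt [ka [la
  [Fphi dom [ep [hs0 ht0]] P _]]]]]]]]]]]]] := leaf_chart p.
have [C' [B' [r' [k' near_t]]]] := patch_axis discriminant_neq0 P hs0 ht0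
  (@chart_circular phi a0 b0 a1 b1 Fphi dom).
have loc s t : a0 < s < b0 -> a1 < t < b1 ->
    circular_leaf a0 b0 (fun s t => x (param phi (row2 s t))) t (C' t) (B' t) (r' t) ->
    (forall s, a0 < s < b0 -> ka s t = k' t) ->
    let q := param phi (row2 s t) in
    [/\ leaf_integral q = first_integral a b c (k' t) (r' t),
      axis_projector q = (B' t)^T *m B' t
    & axis_foot q = C' t - dot (C' t) (B' t) *: B' t].
  move=> hs ht cl hk' q.
  have [eC er eB] := circle_unique (circular_leaf_circle Fphi dom hs ht cl) (hleaf q).
  split.
  - rewrite /leaf_integral er -(hk' s hs) /leaf_curvature eC er.
    by have [_ -> _ _] := patch_leaf P hs ht cl hs.
  - by rewrite /axis_projector; case: eB => ->//;
      rewrite (_ : (- B' t)^T = - (B' t)^T) ?mulNmx ?mulmxN ?opprK//;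
      by apply/matrixP => i j; rewrite !mxE.
  - rewrite /axis_foot eC; case: eB => ->//.
    by rewrite dotNr scaleNr scalerN opprK.
have [ht0' cl0 hk0 _ _] := nbhs_singleton near_t.
have [p1 p2 p3] := loc s0 t0 hs0 ht0 cl0 hk0.
rewrite -ep.
apply: filterS (leaf_chart_near dom hs0 ht0 near_t).
move=> q [s [t [hs ht <- _ [_ cl hk' e1 e2]]]].
have [-> -> ->] := loc s t hs ht cl hk'.
rewrite p1 p2 p3; split; first exact: e1.
by move=> /e2[-> ->].
Qed.

Hypothesis not_umbilic : ~ totally_umbilic k1 k2.

Let connectedS : connected [set: S].
Proof. by have [[]] := hx. Qed.

Lemma leaf_integral_const p q : leaf_integral p = leaf_integral q.
Proof.
apply: connected_locally_constant => // z.
by apply: filterS (leaf_data_near z) => y [].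
Qed.

(** If the constant vanishes then kappa = lam at every point, and
    (k1 - k2)^2 = (kappa + lam)^2 - 4 kappa lam = 0. *)
Lemma leaf_integral_neq0 p : leaf_integral p != 0.
Proof.
apply/eqP => h; apply: not_umbilic => q.
have := leaf_integral_const q p; rewrite h => {h p}.
have [phi [a0 [b0 [a1 [b1 [s0 [t0 [Xs [Xt [Nt [ka [la
  [Fphi dom [ep [hs0 ht0]] P H]]]]]]]]]]]]] := leaf_chart q.
have [C' [B' [r' cl]]] := chart_circular Fphi dom ht0.
have [r0 _ _] := cl.
have lc := circular_leaf_circle Fphi dom hs0 ht0 cl; rewrite ep in lc.
have [eC er _] := circle_unique lc (hleaf q).
have [_ ek _ _] := patch_leaf P hs0 ht0 cl hs0; rewrite ep -eC -er in ek.
rewrite /leaf_integral /leaf_curvature -ek er /first_integral => /eqP.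
rewrite mulf_eq0 expf_eq0/= (gt_eqF r0) /= => /eqP.
have lw := patch_weingarten P hs0 ht0.
have slope := weingarten_slope discriminant_neq0 lw.
have := H _ _ hs0 ht0; rewrite /= ep; move: lw slope.
move: (ka s0 t0) (la s0 t0) => k l lw slope [sum prod] h.
have kl : k = l.
  apply/eqP; rewrite -subr_eq0; apply/eqP; apply: (mulfI slope); rewrite mulr0.
  by rewrite -[RHS](subrr (0 : R)) -{1}h -lw; ring.
have : (k1 q - k2 q) ^+ 2 = 0.
  transitivity ((k1 q + k2 q) ^+ 2 - 4 * (k1 q * k2 q)); first by ring.
  by rewrite -sum -prod kl; ring.
by move=> /eqP; rewrite sqrf_eq0 subr_eq0 => /eqP.
Qed.

Lemma axis_projector_const p q : axis_projector p = axis_projector q.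
Proof.
apply: connected_locally_constant => // z.
by apply: filterS (leaf_data_near z) => y [_ /(_ (leaf_integral_neq0 z)) []].
Qed.

Lemma axis_foot_const p q : axis_foot p = axis_foot q.
Proof.
apply: connected_locally_constant => // z.
by apply: filterS (leaf_data_near z) => y [_ /(_ (leaf_integral_neq0 z)) []].
Qed.

(** The first two frame vectors are the radius at p0 and its quarter turn about
    the axis. *)
Lemma common_axis (p0 : S) : exists (o e1 e2 e3 : 'rV[R]_3), orthonormal3 e1 e2 e3 /\
  forall p, exists h r, leaf_circle p (o + h *: e3) e3 r.
Proof.
have [r0 BB [phi [u [_ hu eu /(_ u hu erefl)[+ +]]]]] := hleaf p0.
rewrite eu => XX XB; pose e1 := (r p0)^-1 *: (x p0 - C p0).
have r0' := lt0r_neq0 r0.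
have h11 : dot e1 e1 = 1 by rewrite !dotZl !dotZr XX; field.
have h1B : dot e1 (B p0) = 0 by rewrite dotZl XB mulr0.
exists (axis_foot p0), e1, (cross (B p0) e1), (B p0); split.
  split=> //; last by rewrite dot_crossl.
  by split=> //; [rewrite cross_norm2 BB h11 dotC h1B; ring|rewrite dotC dot_crossr].
move=> p; have [rp BBp _] := hleaf p.
have eB : B p = dot (B p) (B p0) *: B p0.
  have E (v w : 'rV[R]_3) : v *m (w^T *m w) = dot v w *: w.
    by rewrite mulmxA (mx11_scalar (v *m w^T)) mul_scalar_mx.
  by have := E (B p) (B p); rewrite -/(axis_projector p) (axis_projector_const p p0)
    /axis_projector E BBp scale1r.
have foot : C p = axis_foot p0 + dot (C p) (B p) *: B p.
  by rewrite -(axis_foot_const p) subrK.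
have hp := hleaf p.
exists (dot (C p) (B p) * dot (B p) (B p0)), (r p).
have -> : axis_foot p0 + (dot (C p) (B p) * dot (B p) (B p0)) *: B p0 = C p.
  by rewrite -scalerA -eB -foot.
have : dot (B p) (B p0) ^+ 2 = 1.
  by rewrite -[RHS]BBp {3}eB dotZr expr2.
move=> /eqP; rewrite sqrf_eq1 => /orP[]/eqP e; rewrite e in eB.
  by have := hp; rewrite {1}eB scale1r.
by have := leaf_circleN hp; rewrite {1}eB scaleN1r opprK.
Qed.

End LeafData.

End Revolution.

(** * The profile curve *)
Section Generate.
Variables (R : realType) (S : topologicalType).
Variables (A F : set (chart R S)) (x n : S -> 'rV[R]_3) (k1 k2 : S -> R).
Hypothesis hx : immersed_surface A x n.
Hypothesis hk : principal_curvatures A x n k1 k2.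
Hypothesis hF : foliated_atlas A F.
Hypothesis hlines : consists_of_curvature_lines x n F.
Hypothesis hcirc : consists_of_circular_arcs x F.
Variables (a b c : R).
Hypothesis hW : forall p,
  a * gauss_curvature k1 k2 p + 2 * b * mean_curvature k1 k2 p + c = 0.
Hypothesis discriminant_neq0 : discriminant a b c != 0.
Variables (o e3 : 'rV[R]_3).
Hypothesis e33 : dot e3 e3 = 1.
Hypothesis haxis : forall p, exists h r, leaf_circle F x p (o + h *: e3) e3 r.

Definition state (p : S) := profile_state o e3 (x p) (n p).

(** In a foliated chart the state depends on the transverse coordinate only and
    follows the field up to a nonvanishing speed. *)
Lemma local_profile (p : S) : exists (l u : R) (z : R -> 'rV[R]_4) (theta : S -> R),
  integral_curve a b c l u z /\ \forall q \near p,
    [/\ {for q, continuous theta}, l < theta q < u & z (theta q) = state q].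
Proof.
have [phi [a0 [b0 [a1 [b1 [s0 [t0 [Xs [Xt [Nt [ka [la
  [Fphi dom [<- [hs0 ht0]] P _]]]]]]]]]]]]] := leaf_chart hx hk hF hlines hW p.
pose X s t := x (param phi (row2 s t)); pose N s t := n (param phi (row2 s t)).
have leaves t : a1 < t < b1 -> exists h r, circular_leaf a0 b0 X t (o + h *: e3) e3 r.
  move=> ht; have [C [B [r cl]]] := chart_circular hcirc Fphi dom ht.
  have lc := circular_leaf_circle Fphi dom hs0 ht cl.
  have [h [r' lc']] := haxis (param phi (row2 s0 t)).
  have [eC er eB] := leaf_circle_unique hx hk hF hlines lc lc'.
  exists h, r'; rewrite eC er; case: eB => ->; first exact: cl.
  exact: circular_leafN cl.
have [g hg] := patch_state_derive discriminant_neq0 P e33 leaves hs0.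
have H t : a1 < t < b1 -> [/\ is_derive t 1 (fun t => profile_state o e3 (X s0 t) (N s0 t))
      (g t *: profile_field a b c (profile_state o e3 (X s0 t) (N s0 t))),
    g t != 0, {for t, continuous g}
    & regular_state a b (profile_state o e3 (X s0 t) (N s0 t))].
  by move=> /hg /= [h1 h2 h3 h4 h5].
have [l [u [z [tau [hz near_t]]]]] := reparametrize ht0 H.
exists l, u, z, (fun q => tau (coords phi q 0 1)); split; first exact: hz.
apply: filterS (leaf_chart_near dom hs0 ht0 near_t) => q.
move=> [s [t [hs ht eq ecq [h1 h2 h3]]]].
have ht1 : a1 < t < b1 := ht.
split.
- have hq : (param phi @` pdom phi) q by exists (row2 s t) => //; rewrite dom /= !row2E.
  have cc : {for q, continuous (fun q => coords phi q 0 1)}.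
    exact: (cvg_comp _ _ (coords_continuous_at hq) (@coord_continuous _ _ _ 0 1 _)).
  have ct : {for coords phi q 0 1, continuous tau} by rewrite ecq row2E.
  exact: (cvg_comp _ _ cc ct).
- by rewrite ecq row2E.
- rewrite ecq row2E h3 /state -eq.
  exact: (patch_state_const P e33 leaves hs0 hs ht).
Qed.

Variable p0 : S.
Local Notation y0 := (state p0).

(** Being on the maximal curve is a locally constant property: near q all states
    lie on one integral curve, which is absorbed by the maximal curve as soon as
    one of them is reached. *)
Lemma on_profile p : exists t, max_dom a b c y0 t /\ max_curve a b c y0 t = state p.
Proof.
pose G p := exists t, max_dom a b c y0 t /\ max_curve a b c y0 t = state p.
have lc q : \forall q' \near q, G q' = G q.
  have [l [u [z [th [hz near_q]]]]] := local_profile q.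
  have [_ hq eq] := nbhs_singleton near_q.
  apply: filterS near_q => q' [_ hq' eq']; apply/propext; split.
  - move=> [t [ht e]].
    have [h1 h2] := max_curve_extend hz hq' ht (etrans eq' (esym e)) hq.
    by exists (t + (th q - th q')); split; [exact: h1|rewrite h2].
  - move=> [t [ht e]].
    have [h1 h2] := max_curve_extend hz hq ht (etrans eq (esym e)) hq'.
    by exists (t + (th q' - th q)); split; [exact: h1|rewrite h2].
have cS : connected [set: S] by have [[]] := hx.
change (G p); rewrite (connected_locally_constant cS lc p p0).
have [l [u [z [th [hz near_q]]]]] := local_profile p0.
have [_ hq eq] := nbhs_singleton near_q.
have hw := integral_curve_shift (d := th p0) hz.
have h0 : l - th p0 < 0 < u - th p0 by lra.
have w0 : z (0 + th p0) = y0 by rewrite add0r.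
exists 0; split; last by rewrite (max_curveE h0 hw w0 h0) add0r.
by exists (l - th p0), (u - th p0), (fun t => z (t + th p0)).
Qed.

Lemma revolution_of_axis e1 e2 : orthonormal3 e1 e2 e3 -> surface_of_revolution x.
Proof.
move=> ho; exists o, e1, e2, e3, (max_dom a b c y0), (profile a b c y0); split.
- exact: ho.
- by split; [exact: open_max_dom|exact: is_interval_max_dom].
- by split; [exact: profile_smooth|move=> t; exact: profile_derive1].
move=> p; have [t1 [ht1 e]] := on_profile p.
have [l [u [z [th [hz near_p]]]]] := local_profile p.
have [_ hp ep] := nbhs_singleton near_p.
exists (fun q => t1 + (th q - th p)); apply: filterS near_p => q [cq hq eq].
have [h1 h2] := max_curve_extend hz hp ht1 (etrans ep (esym e)) hq.
split; [|exact: h1|].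
  apply: cvgD; first exact: cvg_cst.
  by apply: cvgB; [exact: cq|exact: cvg_cst].
rewrite /profile !row2E h2 eq /state /profile_state !row4E.
have rB : dot (axis_radial o e3 (x q)) e3 = 0.
  by rewrite /axis_radial opprD addrA dotDl dotNl dotZl e33 mulr1 /axis_height subrr.
have [al E] := polar_frame ho rB; exists al; rewrite -/(axis_radius o e3 (x q)) in E.
by rewrite -[LHS](subrK (o + axis_height o e3 (x q) *: e3)) -/(axis_radial o e3 (x q)) E
   addrA [_ + _ + o]addrC addrA.
Qed.

End Generate.

Unset Implicit Arguments.

Theorem theorem2p1 (R : realType) (S : topologicalType) (A : set (chart R S))
    (x n : S -> 'rV[R]_3) (k1 k2 : S -> R)
    (hx : immersed_surface A x n)
    (hk : principal_curvatures A x n k1 k2)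
    (hLW : linear_weingarten k1 k2)
    (hnt : ~ tubular k1 k2)
    (hch : channel_surface A x n) :
  surface_of_revolution x.
Proof.
have [F [hF hlines hcirc]] := hch; have [a [b [c [abc hW]]]] := hLW.
have d0 : discriminant a b c != 0.
  by apply/eqP => d; apply: hnt; left; exists a, b, c; split.
have nu : ~ totally_umbilic k1 k2 by move=> h; apply: hnt; right.
have [p0 _] : exists p0, k1 p0 <> k2 p0 by apply/existsNP.
have [f hf] := choice (leaf_circle_exists hx hk hF hlines hcirc hW).
have [org [e1 [e2 [e3 [ho haxis]]]]] := common_axis hx hk hF hlines hcirc hW d0 hf nu p0.
have e33 : dot e3 e3 = 1 by case: ho.
exact: (revolution_of_axis hx hk hF hlines hcirc hW d0 e33 haxis p0 ho).
Qed.
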